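(* Let $n \geq 2$. Then $\dim_K \mathcal{K}_n = 3(n!-1)$ and $$\mathcal{K}_{n+1} = \mathcal{K}_n \oplus \mathcal{K}_n^1 \oplus \dots \oplus \mathcal{K}_n^n \oplus \mathcal{K}_2 x_{n,1} \oplus \dots \oplus \mathcal{K}_2 x_{n,n}.$$
   Context: $K$ is a field of characteristic $0$, $a,b,c\in K$ are generic: $a,b,c$ and $(a-b)(a-c)(b-c)$ are nonzero and $H_3(a,b,c)$, $H_4(a,b,c)$ are split semisimple, where $H_n(a,b,c)=KB_n/((s_1-a)(s_1-b)(s_1-c))$ and $B_n$ is the braid group with Artin generators $s_1,\dots,s_{n-1}$. $\mathcal{K}_n$ is the quotient of $H_n(a,b,c)$ by the two-sided ideal generated by $s_2^2 s_1 - s_1 s_2^2 - s_2 s_1^2 + s_1^2 s_2$ ($\mathcal{K}_2=H_2(a,b,c)$). Inside $\mathcal{K}_{n+1}$, $\mathcal{K}_m$ for $m\le n$ also denotes the image of the natural morphism $\mathcal{K}_m\to\mathcal{K}_{n+1}$, i.e. the subalgebra generated by $s_1,\dots,s_{m-1}$. For $1\le k\le n$: $s_{n,k} = s_n s_{n-1} \cdots s_{n-k+1}$, $\mathcal{K}_n^k = \mathcal{K}_n s_{n,k}$, and $x_{n,k} = s_n s_{n-1} \cdots s_{n-k+2} s_{n-k+1}^2$ (so $x_{n,1}=s_n^2$). *)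

(* Defs.v *)
From HB Require Import structures.
From mathcomp Require Import all_boot all_algebra.
From mathcomp Require Import generic_quotient ring_quotient.
From mathcomp Require Import finmap boolp monalg ring.

Set Implicit Arguments.
Unset Strict Implicit.
Unset Printing Implicit Defensive.

Import GRing.Theory.

Local Open Scope ring_scope.
Local Open Scope quotient_scope.

Section Quotient.
Variables (K : fieldType) (A : algType K) (X : A -> Prop).

Inductive ideal_gen : A -> Prop :=
| ideal_gen0 : ideal_gen 0
| ideal_genX x of X x : ideal_gen x
| ideal_genD x y of ideal_gen x & ideal_gen y : ideal_gen (x + y)
| ideal_genMl x y of ideal_gen y : ideal_gen (x * y)
| ideal_genMr x y of ideal_gen x : ideal_gen (x * y).

(* An [algType] is never the zero ring, so if [X] generates the unit ideal the
   quotient below takes the junk value A / 0; otherwise it is A / (X), see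
   [quot_piP]. All the ideals used in this file are proper as soon as the
   parameter a is nonzero: see [cubic_rel_proper] and [calK_rel_proper]. *)
Definition quot_ideal : {pred A} :=
  fun x => `[< ideal_gen x /\ (ideal_gen 1 -> x = 0) >].

Lemma quot_idealP x :
  reflect (ideal_gen x /\ (ideal_gen 1 -> x = 0)) (x \in quot_ideal).
Proof. exact: asboolP. Qed.

Fact quot_ideal_zmod : zmod_closed quot_ideal.
Proof.
split=> [|x y /quot_idealP[Ix x0] /quot_idealP[Iy y0]]; apply/quot_idealP.
  by split=> //; apply: ideal_gen0.
split=> [|I1]; last by rewrite x0 // y0 // subrr.
by apply: ideal_genD => //; rewrite -mulN1r; apply: ideal_genMl.
Qed.

HB.instance Definition _ := GRing.isZmodClosed.Build A quot_ideal
  quot_ideal_zmod.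

Lemma quot_idealMl x y : y \in quot_ideal -> x * y \in quot_ideal.
Proof.
move=> /quot_idealP[Iy y0]; apply/quot_idealP; split=> [|I1].
  exact: ideal_genMl.
by rewrite y0 // mulr0.
Qed.

Lemma quot_idealMr x y : x \in quot_ideal -> x * y \in quot_ideal.
Proof.
move=> /quot_idealP[Ix x0]; apply/quot_idealP; split=> [|I1].
  exact: ideal_genMr.
by rewrite x0 // mul0r.
Qed.

Lemma quot_ideal1 : 1 \notin quot_ideal.
Proof.
by apply/quot_idealP => -[I1 /(_ I1)/eqP]; rewrite oner_eq0.
Qed.

Definition quot_alg := Quotient.quot quot_ideal.

HB.instance Definition _ := GRing.Zmodule.on quot_alg.
HB.instance Definition _ := EqQuotient.on quot_alg.

Definition quot_pi (x : A) : quot_alg := \pi_quot_alg x.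

Lemma quot_pi_eq x y : quot_pi x = quot_pi y <-> x - y \in quot_ideal.
Proof.
by rewrite /quot_pi Quotient.idealrBE; split=> [->//|/eqP].
Qed.

Lemma quot_piP : ~ ideal_gen 1 ->
  forall x y, quot_pi x = quot_pi y <-> ideal_gen (x - y).
Proof.
by move=> pI x y; rewrite quot_pi_eq; split=> [/quot_idealP[]|Ixy] //;
   apply/quot_idealP.
Qed.

Lemma quot_pi_repr (q : quot_alg) : quot_pi (repr q) = q.
Proof. exact: reprK. Qed.

Lemma quot_ideal_repr x : repr (quot_pi x) - x \in quot_ideal.
Proof. by apply/quot_pi_eq; rewrite quot_pi_repr. Qed.

Definition quot_one : quot_alg := quot_pi 1.
Definition quot_mul (p q : quot_alg) : quot_alg := quot_pi (repr p * repr q).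
Definition quot_scale (k : K) (q : quot_alg) : quot_alg :=
  quot_pi (k *: repr q).

Lemma quot_piM x y : quot_pi (x * y) = quot_mul (quot_pi x) (quot_pi y).
Proof.
apply/esym/quot_pi_eq; set x' := repr _; set y' := repr _.
have -> : x' * y' - x * y = (x' - x) * y' + x * (y' - y).
  by rewrite mulrBl mulrBr addrA subrK.
by apply: rpredD; [apply: quot_idealMr | apply: quot_idealMl];
   apply: quot_ideal_repr.
Qed.

Lemma quot_piZ k x : quot_pi (k *: x) = quot_scale k (quot_pi x).
Proof.
apply/esym/quot_pi_eq; rewrite -scalerBr -mulr_algl.
exact/quot_idealMl/quot_ideal_repr.
Qed.

Lemma quot_piD x y : quot_pi (x + y) = quot_pi x + quot_pi y.
Proof. exact: (Quotient.pi_add quot_ideal). Qed.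

Lemma quot_ind (P : quot_alg -> Prop) :
  (forall x, P (quot_pi x)) -> forall q, P q.
Proof. by move=> PP q; rewrite -[q]quot_pi_repr. Qed.

Fact quot_mulA : associative quot_mul.
Proof.
by elim/quot_ind=> x; elim/quot_ind=> y; elim/quot_ind=> z;
   rewrite -!quot_piM mulrA.
Qed.

Fact quot_mul1 : left_id quot_one quot_mul.
Proof. by elim/quot_ind=> x; rewrite -quot_piM mul1r. Qed.

Fact quot_mulr1 : right_id quot_one quot_mul.
Proof. by elim/quot_ind=> x; rewrite -quot_piM mulr1. Qed.

Fact quot_mulDl : left_distributive quot_mul +%R.
Proof.
by elim/quot_ind=> x; elim/quot_ind=> y; elim/quot_ind=> z;
   rewrite -quot_piD -!quot_piM -quot_piD mulrDl.
Qed.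

Fact quot_mulDr : right_distributive quot_mul +%R.
Proof.
by elim/quot_ind=> x; elim/quot_ind=> y; elim/quot_ind=> z;
   rewrite -quot_piD -!quot_piM -quot_piD mulrDr.
Qed.

Lemma quot_pi0 : quot_pi 0 = 0.
Proof. by apply/(addIr (quot_pi 0)); rewrite -quot_piD !add0r. Qed.

Fact quot_one_neq0 : quot_one != 0.
Proof.
apply/eqP; rewrite -quot_pi0 => /quot_pi_eq.
by rewrite subr0 (negbTE quot_ideal1).
Qed.

HB.instance Definition _ := GRing.Zmodule_isNzRing.Build quot_alg
  quot_mulA quot_mul1 quot_mulr1 quot_mulDl quot_mulDr quot_one_neq0.

Fact quot_scaleA k l q : quot_scale k (quot_scale l q) = quot_scale (k * l) q.
Proof. by elim/quot_ind: q => x; rewrite -!quot_piZ scalerA. Qed.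

Fact quot_scale1 : left_id 1 quot_scale.
Proof. by elim/quot_ind=> x; rewrite -quot_piZ scale1r. Qed.

Fact quot_scaleDr : right_distributive quot_scale +%R.
Proof.
by move=> k; elim/quot_ind=> x; elim/quot_ind=> y;
   rewrite -quot_piD -!quot_piZ -quot_piD scalerDr.
Qed.

Fact quot_scaleDl q : {morph quot_scale^~ q : k l / k + l}.
Proof. by elim/quot_ind: q => x k l; rewrite -!quot_piZ -quot_piD scalerDl. Qed.

HB.instance Definition _ := GRing.Zmodule_isLmodule.Build K quot_alg
  quot_scaleA quot_scale1 quot_scaleDr quot_scaleDl.

Fact quot_scaleAl k (p q : quot_alg) : k *: (p * q) = (k *: p) * q.
Proof.
elim/quot_ind: p => x; elim/quot_ind: q => y.
by rewrite /GRing.mul /GRing.scale /= -!(quot_piM, quot_piZ) scalerAl.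
Qed.

HB.instance Definition _ := GRing.Lmodule_isLalgebra.Build K quot_alg
  quot_scaleAl.

Fact quot_scaleAr k (p q : quot_alg) : k *: (p * q) = p * (k *: q).
Proof.
elim/quot_ind: p => x; elim/quot_ind: q => y.
by rewrite /GRing.mul /GRing.scale /= -!(quot_piM, quot_piZ) scalerAr.
Qed.

HB.instance Definition _ := GRing.Lalgebra_isAlgebra.Build K quot_alg
  quot_scaleAr.

End Quotient.

Arguments quot_alg {K A} X.
Arguments quot_pi {K A} X x.

(* One-dimensional characters are only used to show that the ideals by which
   we quotient are proper. *)
Definition is_char (K : fieldType) (A : algType K) (f : A -> K) : Prop :=
  [/\ {morph f : x y / x + y}, forall k x, f (k *: x) = k * f x,
      f 1 = 1 & {morph f : x y / x * y}].

Lemma is_charB (K : fieldType) (A : algType K) (f : A -> K) :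
  is_char f -> {morph f : x y / x - y}.
Proof. by case=> fD fZ _ _ x y; rewrite fD -scaleN1r fZ mulN1r. Qed.

Lemma cubic_is_char (K : fieldType) (A : algType K) (f : A -> K) (a b c : K) s :
  is_char f -> f s = a -> f ((s - a *: 1) * (s - b *: 1) * (s - c *: 1)) = 0.
Proof.
move=> fc fs; have [_ fZ f1 fM] := fc.
by rewrite !fM !(is_charB fc) !fZ f1 fs mulr1 subrr !mul0r.
Qed.

Lemma commutator_is_char (K : fieldType) (A : algType K) (f : A -> K) s t :
  is_char f -> f (t ^+ 2 * s - s * t ^+ 2 - t * s ^+ 2 + s ^+ 2 * t) = 0.
Proof.
move=> fc; have [fD _ _ fM] := fc.
by rewrite fD !(is_charB fc) !expr2 !fM; ring.
Qed.

Section Characters.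
Variables (K : fieldType) (A : algType K) (f : A -> K) (X : A -> Prop).
Hypotheses (f_char : is_char f) (fX : forall x, X x -> f x = 0).

Lemma ideal_gen_char x : ideal_gen X x -> f x = 0.
Proof.
case: f_char => fD _ f1 fM; elim=> {x} [|x /fX //|x y _ fx _ fy|x y _ fy|x y _ fx].
- by apply/(addIr (f 0)); rewrite -fD !add0r.
- by rewrite fD fx fy addr0.
- by rewrite fM fy mulr0.
- by rewrite fM fx mul0r.
Qed.

Lemma ideal_gen_proper : ~ ideal_gen X 1.
Proof.
by move=> /ideal_gen_char/eqP; case: f_char => _ _ -> _; rewrite oner_eq0.
Qed.

Definition quot_char (q : quot_alg X) : K := f (repr q).

Lemma quot_char_pi x : quot_char (quot_pi X x) = f x.
Proof.
have [fD _ _ _] := f_char; rewrite /quot_char -[LHS](congr1 f (subrK x _)) fD.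
by rewrite ideal_gen_char ?add0r //; case/quot_idealP: (quot_ideal_repr X x).
Qed.

Lemma quot_char_is_char : is_char quot_char.
Proof.
have [fD fZ f1 fM] := f_char; split=> [|k||].
- elim/quot_ind=> x; elim/quot_ind=> y.
  by rewrite -quot_piD !quot_char_pi fD.
- by elim/quot_ind=> x; rewrite -[_ *: _]quot_piZ !quot_char_pi fZ.
- by rewrite quot_char_pi f1.
- elim/quot_ind=> x; elim/quot_ind=> y.
  by rewrite -[_ * _]quot_piM !quot_char_pi fM.
Qed.

End Characters.

(* [{malg K[G]}] is the K-module of finitely supported functions on [G];
   monalg.v only multiplies over monoids whose sole unit is 1, hence the
   convolution product below, where [<< c *g g >>] is c.g *)
Section GroupAlgebra.
Variables (K : fieldType) (G : groupType).

Definition grpalg : Type := {malg K[G]}.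

HB.instance Definition _ := GRing.Lmodule.on grpalg.

Implicit Types x y z : grpalg.

Definition grpalg_one : grpalg := << 1 *g 1%g >>.
Definition grpalg_mul x y : grpalg :=
  \sum_(g <- msupp x) \sum_(h <- msupp y) << x@_g * y@_h *g (g * h)%g >>.

Lemma grpalg_mulw (D E : {fset G}) x y : (msupp x `<=` D)%fset -> (msupp y `<=` E)%fset ->
  grpalg_mul x y =
    \sum_(g <- D) \sum_(h <- E) << x@_g * y@_h *g (g * h)%g >>.
Proof.
move=> leD leE; rewrite /grpalg_mul (big_fset_incl _ leD) /=.
  apply/eq_bigr=> g _; apply/big_fset_incl => // h _ /mcoeff_outdom ->.
  by rewrite mulr0 monalgU0.
move=> g _ /mcoeff_outdom xg.
by rewrite big1 => // h _; rewrite xg mul0r monalgU0.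
Qed.

Fact grpalg_mulDl : left_distributive grpalg_mul +%R.
Proof.
move=> x y z; rewrite (grpalg_mulw (msuppD_le x y) (fsubset_refl (msupp z))).
rewrite (grpalg_mulw (fsubsetUl (msupp x) (msupp y)) (fsubset_refl (msupp z))).
rewrite (grpalg_mulw (fsubsetUr (msupp x) (msupp y)) (fsubset_refl (msupp z))).
rewrite -big_split /=; apply/eq_bigr=> g _.
rewrite -big_split /=; apply/eq_bigr=> h _.
by rewrite mcoeffD mulrDl monalgUD.
Qed.

Fact grpalg_mulDr : right_distributive grpalg_mul +%R.
Proof.
move=> z x y; rewrite (grpalg_mulw (fsubset_refl (msupp z)) (msuppD_le x y)).
rewrite (grpalg_mulw (fsubset_refl (msupp z)) (fsubsetUl (msupp x) (msupp y))).
rewrite (grpalg_mulw (fsubset_refl (msupp z)) (fsubsetUr (msupp x) (msupp y))).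
rewrite -big_split /=; apply/eq_bigr=> g _.
rewrite -big_split /=; apply/eq_bigr=> h _.
by rewrite mcoeffD mulrDr monalgUD.
Qed.

Lemma grpalg_mul0g : left_zero 0 grpalg_mul.
Proof. by move=> x; rewrite /grpalg_mul msupp0 big_seq_fset0. Qed.

Lemma grpalg_mulg0 : right_zero 0 grpalg_mul.
Proof.
by move=> x; rewrite /grpalg_mul big1 // => g _; rewrite msupp0 big_seq_fset0.
Qed.

Lemma grpalg_mulUU c d (g h : G) :
  grpalg_mul << c *g g >> << d *g h >> = << c * d *g (g * h)%g >>.
Proof.
by rewrite (grpalg_mulw msuppU_le msuppU_le) !big_seq_fset1 !mcoeffUU.
Qed.

Lemma grpalg_ind (P : grpalg -> Prop) :
    P 0 -> (forall x y, P x -> P y -> P (x + y)) ->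
  (forall c g, P << c *g g >>) -> forall x, P x.
Proof.
move=> P0 PD PU x; rewrite [x]monalgE.
by elim/big_ind: _ => // g _; apply: PU.
Qed.

Fact grpalg_mul1g : left_id grpalg_one grpalg_mul.
Proof.
elim/grpalg_ind=> [|x y Px Py|c g]; first exact: grpalg_mulg0.
  by rewrite grpalg_mulDr Px Py.
by rewrite grpalg_mulUU mul1r mul1g.
Qed.

Fact grpalg_mulg1 : right_id grpalg_one grpalg_mul.
Proof.
elim/grpalg_ind=> [|x y Px Py|c g]; first exact: grpalg_mul0g.
  by rewrite grpalg_mulDl Px Py.
by rewrite grpalg_mulUU mulr1 mulg1.
Qed.

Fact grpalg_mulA : associative grpalg_mul.
Proof.
elim/grpalg_ind=> [|x y Px Py|c g] z t; first by rewrite !grpalg_mul0g.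
  by rewrite !grpalg_mulDl Px Py.
elim/grpalg_ind: z => [|x y Px Py|d h].
- by rewrite grpalg_mul0g !grpalg_mulg0 grpalg_mul0g.
- by rewrite grpalg_mulDl !grpalg_mulDr grpalg_mulDl Px Py.
elim/grpalg_ind: t => [|x y Px Py|e k]; first by rewrite !grpalg_mulg0.
  by rewrite !grpalg_mulDr Px Py.
by rewrite !grpalg_mulUU mulrA mulgA.
Qed.

Fact grpalg_one_neq0 : grpalg_one != 0.
Proof. by rewrite monalgU_eq0 oner_eq0. Qed.

HB.instance Definition _ := GRing.Zmodule_isNzRing.Build grpalg
  grpalg_mulA grpalg_mul1g grpalg_mulg1 grpalg_mulDl grpalg_mulDr
  grpalg_one_neq0.

Lemma grpalgMU c d (g h : G) :
  (<< c *g g >> : grpalg) * << d *g h >> = << c * d *g (g * h)%g >>.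
Proof. exact: grpalg_mulUU. Qed.

Lemma grpalg_scaleU k c (g : G) :
  k *: (<< c *g g >> : grpalg) = << k * c *g g >>.
Proof. by apply/malgP=> h; rewrite mcoeffZ !mcoeffU mulrnAr. Qed.

Fact grpalg_scaleAl k x y : k *: (x * y) = (k *: x) * y.
Proof.
elim/grpalg_ind: x => [|x z Px Pz|c g].
- by rewrite mul0r scaler0 mul0r.
- by rewrite mulrDl !scalerDr mulrDl Px Pz.
elim/grpalg_ind: y => [|x z Px Pz|d h].
- by rewrite !mulr0 scaler0.
- by rewrite !mulrDr scalerDr Px Pz.
by rewrite grpalg_scaleU !grpalgMU grpalg_scaleU mulrA.
Qed.

HB.instance Definition _ := GRing.Lmodule_isLalgebra.Build K grpalg
  grpalg_scaleAl.

Fact grpalg_scaleAr k x y : k *: (x * y) = x * (k *: y).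
Proof.
elim/grpalg_ind: x => [|x z Px Pz|c g].
- by rewrite !mul0r scaler0.
- by rewrite !mulrDl scalerDr Px Pz.
elim/grpalg_ind: y => [|x z Px Pz|d h].
- by rewrite !(mulr0, scaler0).
- by rewrite mulrDr !scalerDr mulrDr Px Pz.
by rewrite grpalg_scaleU !grpalgMU grpalg_scaleU mulrCA.
Qed.

HB.instance Definition _ := GRing.Lalgebra_isAlgebra.Build K grpalg
  grpalg_scaleAr.

Definition grpalg_in (g : G) : grpalg := << 1 *g g >>.

Section Extension.
Variable chi : G -> K.

Definition grpalg_ext (x : grpalg) : K := \sum_(g <- msupp x) x@_g * chi g.

Lemma grpalg_extw (D : {fset G}) x : (msupp x `<=` D)%fset ->
  grpalg_ext x = \sum_(g <- D) x@_g * chi g.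
Proof.
move=> leD; rewrite /grpalg_ext (big_fset_incl _ leD) //= => g _.
by move/mcoeff_outdom ->; rewrite mul0r.
Qed.

Lemma grpalg_extU c g : grpalg_ext << c *g g >> = c * chi g.
Proof. by rewrite (grpalg_extw msuppU_le) big_seq_fset1 mcoeffUU. Qed.

Fact grpalg_ext_additive : {morph grpalg_ext : x y / x + y}.
Proof.
move=> x y; rewrite (grpalg_extw (msuppD_le x y)).
rewrite (grpalg_extw (fsubsetUl (msupp x) (msupp y))).
rewrite (grpalg_extw (fsubsetUr (msupp x) (msupp y))) -big_split /=.
by apply/eq_bigr=> g _; rewrite mcoeffD mulrDl.
Qed.

Lemma grpalg_ext0 : grpalg_ext 0 = 0.
Proof. by rewrite /grpalg_ext msupp0 big_seq_fset0. Qed.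

Hypothesis chi1 : chi 1%g = 1.
Hypothesis chiM : {morph chi : g h / (g * h)%g >-> g * h}.

Lemma grpalg_ext_char : is_char grpalg_ext.
Proof.
have D := grpalg_ext_additive; split=> // [k x||x y].
- elim/grpalg_ind: x => [|x y Px Py|c g].
  + by rewrite scaler0 grpalg_ext0 mulr0.
  + by rewrite scalerDr !D mulrDr Px Py.
  + by rewrite grpalg_scaleU !grpalg_extU mulrA.
- by rewrite grpalg_extU chi1 mulr1.
elim/grpalg_ind: x => [|x z Px Pz|c g]; first by rewrite !(mul0r, grpalg_ext0).
  by rewrite mulrDl !D mulrDl Px Pz.
elim/grpalg_ind: y => [|x z Px Pz|d h]; first by rewrite !(mulr0, grpalg_ext0).
  by rewrite mulrDr !D mulrDr Px Pz.
by rewrite grpalgMU !grpalg_extU chiM mulrACA.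
Qed.

End Extension.

End GroupAlgebra.

Section PresentedGroup.
Variables (I : choiceType).

(* (i, true) stands for the generator i, and (i, false) for its inverse *)
Definition word := seq (I * bool).

Definition word_inv (w : word) : word := rev [seq (l.1, ~~ l.2) | l <- w].

Variable R : word -> word -> Prop.

Inductive pres_eq : word -> word -> Prop :=
| pres_eq_rel u v of R u v : pres_eq u v
| pres_eq_cancel i b : pres_eq [:: (i, b); (i, ~~ b)] [::]
| pres_eq_cat u u' v v' of pres_eq u u' & pres_eq v v' :
    pres_eq (u ++ v) (u' ++ v')
| pres_eq_refl u : pres_eq u u
| pres_eq_sym u v of pres_eq u v : pres_eq v u
| pres_eq_trans u v w of pres_eq u v & pres_eq v w : pres_eq u w.

Definition pres_eqb (u v : word) : bool := `[< pres_eq u v >].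

Fact pres_eqb_equiv : equiv_class_of pres_eqb.
Proof.
split=> [u|u v|v u w].
- exact/asboolP/pres_eq_refl.
- by apply/asboolP/asboolP; apply: pres_eq_sym.
- by move=> /asboolP uv /asboolP vw; apply/asboolP/(pres_eq_trans uv).
Qed.

Canonical pres_eqb_equivRel := EquivRelPack pres_eqb_equiv.
Canonical pres_eqb_encModRel := defaultEncModRel pres_eqb.

Definition presgroup := {eq_quot pres_eqb}.

HB.instance Definition _ := Choice.on presgroup.
HB.instance Definition _ := EqQuotient.on presgroup.

Definition pres_class (w : word) : presgroup := \pi_presgroup w.

Lemma pres_classP u v : pres_class u = pres_class v <-> pres_eq u v.
Proof.
split=> [/eqP|uv]; first by rewrite eqmodE => /asboolP.
by apply/eqP; rewrite eqmodE; apply/asboolP.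
Qed.

Lemma pres_class_repr (x : presgroup) : pres_class (repr x) = x.
Proof. exact: reprK. Qed.

Lemma pres_eq_repr w : pres_eq (repr (pres_class w)) w.
Proof. by apply/pres_classP; rewrite pres_class_repr. Qed.

Lemma pres_ind (P : presgroup -> Prop) :
  (forall w, P (pres_class w)) -> forall x, P x.
Proof. by move=> PP x; rewrite -[x]pres_class_repr. Qed.

Lemma word_invK : involutive word_inv.
Proof.
move=> w; rewrite /word_inv map_rev revK -map_comp -[RHS]map_id.
by apply: eq_map => -[i b] /=; rewrite negbK.
Qed.

Lemma pres_eq_mulV w : pres_eq (w ++ word_inv w) [::].
Proof.
elim/last_ind: w => [|w [i b] IHw]; first exact: pres_eq_refl.
rewrite /word_inv map_rcons rev_rcons -cats1 -catA /=.
apply: pres_eq_trans IHw; apply: pres_eq_cat; first exact: pres_eq_refl.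
exact: (pres_eq_cat (pres_eq_cancel i b) (pres_eq_refl (word_inv w))).
Qed.

Lemma pres_eq_Vmul w : pres_eq (word_inv w ++ w) [::].
Proof. by rewrite -{2}[w]word_invK; apply: pres_eq_mulV. Qed.

Lemma pres_eq_inv u v : pres_eq u v -> pres_eq (word_inv u) (word_inv v).
Proof.
move=> uv; apply: (@pres_eq_trans _ (word_inv u ++ (v ++ word_inv v))).
  rewrite -[X in pres_eq X]cats0; apply: pres_eq_cat; first exact: pres_eq_refl.
  exact/pres_eq_sym/pres_eq_mulV.
rewrite catA -[X in pres_eq _ X]cat0s; apply: pres_eq_cat.
  apply: pres_eq_trans (pres_eq_Vmul u).
  by apply: pres_eq_cat; [apply: pres_eq_refl | apply: pres_eq_sym].
exact: pres_eq_refl.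
Qed.

Definition pres_one : presgroup := pres_class [::].
Definition pres_mul (x y : presgroup) : presgroup :=
  pres_class (repr x ++ repr y).
Definition pres_inv (x : presgroup) : presgroup :=
  pres_class (word_inv (repr x)).

Lemma pres_classM u v :
  pres_class (u ++ v) = pres_mul (pres_class u) (pres_class v).
Proof.
by apply/esym/pres_classP; apply: pres_eq_cat; apply: pres_eq_repr.
Qed.

Lemma pres_classV u : pres_class (word_inv u) = pres_inv (pres_class u).
Proof. by apply/esym/pres_classP; apply/pres_eq_inv/pres_eq_repr. Qed.

Fact pres_mulA : associative pres_mul.
Proof.
by elim/pres_ind=> u; elim/pres_ind=> v; elim/pres_ind=> w;
   rewrite -!pres_classM catA.
Qed.

Fact pres_mul1 : left_id pres_one pres_mul.
Proof. by elim/pres_ind=> u; rewrite -pres_classM. Qed.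

Fact pres_mulr1 : right_id pres_one pres_mul.
Proof. by elim/pres_ind=> u; rewrite -pres_classM cats0. Qed.

Fact pres_mulV : left_inverse pres_one pres_inv pres_mul.
Proof.
elim/pres_ind=> u; rewrite -pres_classV -pres_classM.
exact/pres_classP/pres_eq_Vmul.
Qed.

Fact pres_mulrV : right_inverse pres_one pres_inv pres_mul.
Proof.
elim/pres_ind=> u; rewrite -pres_classV -pres_classM.
exact/pres_classP/pres_eq_mulV.
Qed.

HB.instance Definition _ := isGroup.Build presgroup
  pres_mulA pres_mul1 pres_mulr1 pres_mulV pres_mulrV.

Definition pres_gen (i : I) : presgroup := pres_class [:: (i, true)].

End PresentedGroup.

Definition artin_index (n : nat) : choiceType := {i : nat | (0 < i < n)%N}.

Inductive artin_rel (n : nat) :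
    word (artin_index n) -> word (artin_index n) -> Prop :=
| artin_braid (i j : artin_index n) of val j = (val i).+1 :
    artin_rel [:: (i, true); (j, true); (i, true)]
              [:: (j, true); (i, true); (j, true)]
| artin_comm (i j : artin_index n) of ((val i).+1 < val j)%N :
    artin_rel [:: (i, true); (j, true)] [:: (j, true); (i, true)].

Definition braid_group (n : nat) : groupType := presgroup (@artin_rel n).

(* The Artin generator s_i for 0 < i < n, and 1 for other values of i. *)
Definition artin (n i : nat) : braid_group n :=
  if insub i is Some j then pres_gen (@artin_rel n) j else 1%g.

Section BraidCharacter.
Variables (K : fieldType) (a : K) (n : nat).
Hypothesis a_neq0 : a != 0.

Definition word_char (w : word (artin_index n)) : K :=
  \prod_(l <- w) (if l.2 then a else a^-1).

Lemma word_char_eq u v : pres_eq (@artin_rel n) u v -> word_char u = word_char v.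
Proof.
rewrite /word_char; elim=> {u v} [u v [] i j _ | i b | u u' v v' _ Eu _ Ev | //
  | u v _ -> // | u v w _ -> _ -> //].
- by rewrite !big_cons !big_nil.
- by rewrite !big_cons !big_nil.
- by rewrite !big_cons big_nil mulr1; case: b => /=; rewrite ?mulfV ?mulVf.
- by rewrite !big_cat /= Eu Ev.
Qed.

Definition braid_char (x : braid_group n) : K := word_char (repr x).

Lemma braid_char_class w : braid_char (pres_class _ w) = word_char w.
Proof. exact/word_char_eq/pres_eq_repr. Qed.

Lemma braid_char1 : braid_char 1%g = 1.
Proof. by rewrite [LHS]braid_char_class /word_char big_nil. Qed.

Lemma braid_charM : {morph braid_char : x y / (x * y)%g >-> x * y}.
Proof.
elim/pres_ind=> u; elim/pres_ind=> v.
rewrite -[(_ * _)%g]pres_classM !braid_char_class.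
by rewrite /word_char big_cat.
Qed.

Lemma braid_char_artin i : (0 < i < n)%N -> braid_char (artin n i) = a.
Proof.
move=> lt_i; rewrite /artin insubT /=.
by rewrite braid_char_class /word_char big_cons big_nil mulr1.
Qed.

End BraidCharacter.

Section CubicAlgebras.
Variables (K : fieldType) (a b c : K) (n : nat).

(* For n < 2 there is no generator s_1, hence no cubic relation. *)
Definition cubic_rel (x : grpalg K (braid_group n)) : Prop :=
  let s1 := grpalg_in K (artin n 1) in
  (1 < n)%N /\ x = (s1 - a *: 1) * (s1 - b *: 1) * (s1 - c *: 1).

Definition cubicH : algType K := quot_alg cubic_rel.

Definition cubicH_gen (i : nat) : cubicH :=
  quot_pi cubic_rel (grpalg_in K (artin n i)).

(* Empty for n < 3, so that K_2 = H_2. *)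
Definition calK_rel (x : cubicH) : Prop :=
  let s1 := cubicH_gen 1 in
  let s2 := cubicH_gen 2 in
  (2 < n)%N /\
  x = s2 ^+ 2 * s1 - s1 * s2 ^+ 2 - s2 * s1 ^+ 2 + s1 ^+ 2 * s2.

Definition calK : algType K := quot_alg calK_rel.

Definition calK_gen (i : nat) : calK := quot_pi calK_rel (cubicH_gen i).

Lemma cubic_char : a != 0 -> is_char (grpalg_ext (@braid_char K a n)) /\
  forall x, cubic_rel x -> grpalg_ext (@braid_char K a n) x = 0.
Proof.
move=> a0; have fc := grpalg_ext_char (braid_char1 n a0) (@braid_charM _ _ n a0).
split=> // _ [n1 ->].
rewrite (cubic_is_char b c fc) // grpalg_extU mul1r.
exact: braid_char_artin.
Qed.

Lemma cubic_rel_proper : a != 0 -> ~ ideal_gen cubic_rel 1.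
Proof. by case/cubic_char=> fc fX; apply: ideal_gen_proper fc fX. Qed.

Lemma calK_rel_proper : a != 0 -> ~ ideal_gen calK_rel 1.
Proof.
case/cubic_char=> fc fX; have gc := quot_char_is_char fc fX.
apply: (ideal_gen_proper gc) => _ [_ ->].
exact: commutator_is_char gc.
Qed.

End CubicAlgebras.

Section Subspaces.
Variables (K : fieldType) (A : algType K).

(* The [f i] jointly identify A with a finite direct product of matrix
   algebras over K ("split": matrix algebras over K itself, not over larger
   division algebras). *)
Definition split_semisimple : Prop :=
  exists (r : nat) (d : 'I_r -> nat)
         (f : forall i : 'I_r, {lrmorphism A -> 'M[K]_((d i).+1)}),
    forall M : forall i : 'I_r, 'M[K]_((d i).+1),
      exists! x : A, forall i, f i x = M i.

Definition has_dim (d : nat) : Prop := inhabited (Vector.axiom d A).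

Inductive subalg_gen (X : A -> Prop) : A -> Prop :=
| subalg_gen1 : subalg_gen X 1
| subalg_genX x of X x : subalg_gen X x
| subalg_genD x y of subalg_gen X x & subalg_gen X y : subalg_gen X (x + y)
| subalg_genZ k x of subalg_gen X x : subalg_gen X (k *: x)
| subalg_genM x y of subalg_gen X x & subalg_gen X y : subalg_gen X (x * y).

Definition rtranslate (W : A -> Prop) (x : A) : A -> Prop :=
  fun v => exists2 w, W w & v = w * x.

(* A is the internal direct sum of the entries of [Ws], which are meant to be
   linear subspaces. *)
Definition is_direct_sum (Ws : seq (A -> Prop)) : Prop :=
  forall v : A, exists! u : {ffun 'I_(size Ws) -> A},
    (forall i, tnth (in_tuple Ws) i (u i)) /\ v = \sum_i u i.

End Subspaces.

Arguments split_semisimple {K} A.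
Arguments has_dim {K} A d.

Section Decomposition.
Variables (K : fieldType) (a b c : K) (n : nat).

Local Notation s := (@calK_gen K a b c n.+1).

(* The image of K_m in K_{n+1}, for m <= n. *)
Definition calK_sub (m : nat) : calK a b c n.+1 -> Prop :=
  subalg_gen (fun x => exists2 i, (0 < i < m)%N & x = s i).

(* s_n s_{n-1} ... s_{n-k+1} *)
Definition s_desc (k : nat) : calK a b c n.+1 :=
  \prod_(0 <= j < k) s (n - j).

(* s_n s_{n-1} ... s_{n-k+2} s_{n-k+1}^2 *)
Definition x_desc (k : nat) : calK a b c n.+1 :=
  s_desc k.-1 * s (n - k).+1 ^+ 2.

End Decomposition.

(* Main.v *)
Require Import Defs.
From HB Require Import structures.
From mathcomp Require Import all_boot all_algebra.
From mathcomp Require Import finmap functions boolp monalg ring zify.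

Set Implicit Arguments.
Unset Strict Implicit.
Unset Printing Implicit Defensive.

Import GRing.Theory.

Local Open Scope ring_scope.

(* Write p_t(s_i) for the spectral projector of s_i on the eigenvalue t in {a, b, c}. The relation of K_3 says exactly
   that p_t(s_1) p_u(s_2) - p_u(s_1) p_t(s_2) = p_u(s_2) p_t(s_1) - p_t(s_2) p_u(s_1) for all t, u. Together with
   s_1 s_2 s_1 = s_2 s_1 s_2 this forces p_a(s_i) p_b(s_{i+1}) p_c(s_k) = 0 for i + 1 < k, whatever the ordering of the
   eigenvalues. Hence, modulo K_n + K_n s_n, all of s_1, ..., s_{n-1} act on p_t(s_1) s_n^2 by t, which cuts K_n s_n^2
   down to K_2 s_n^2 and shows that the announced sum is stable under right multiplication by the generators.

   Independence comes from the representations of K_n that factor through the three Hecke algebras with eigenvalues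
   {t, u}. In such a quotient x_{n,k} = (t + u) s_{n,k} - t u s_{n,k-1} and the s_{n,k} are free over the smaller Hecke
   algebra, so a relation sum_k f_k s_{n,k} + g_k x_{n,k} = 0 gives f_k + (t + u) g_k - t u g_{k+1} = 0 for every pair
   {t, u}. Going down from k = n, the character s_i |-> t of the quotients {t, u} and {t, v} kills g_k, hence f_k acts
   as 0 in the three quotients, and by induction on n it vanishes. *)

(** * Spectral projectors *)

(* Labels for the three eigenvalues a, b, c. *)
Variant color := Red | Green | Blue.

Definition rainbow (x y z : color) := [/\ x <> y, y <> z & x <> z].

Lemma color_eq_dec (x y : color) : x = y \/ x <> y.
Proof. by case: x; case: y; (by left) || right. Qed.

Lemma rainbow_complete x y : x <> y -> exists z, rainbow x y z.
Proof.
by case: x; case: y => // _; [exists Blue|exists Green|exists Blue|exists Red|exists Green|exists Red].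
Qed.

Lemma rainbow_sum (V : zmodType) (F : color -> V) x y z :
  rainbow x y z -> F x + F y + F z = F Red + F Green + F Blue.
Proof.
case; case: x; case: y => //; case: z => // _ _ _.
- exact: addrAC.
- by rewrite [F Green + _]addrC.
- by rewrite addrC addrA.
- by rewrite -addrA addrC.
- by rewrite addrC [F Blue + _]addrC addrA.
Qed.

Section Resolutions.
Variable A : nzRingType.
Implicit Types p q r : color -> A.

Definition resolution p :=
  [/\ p Red + p Green + p Blue = 1, forall x, p x * p x = p x
    & forall x y, x <> y -> p x * p y = 0].

(** What is kept of two adjacent generators with projectors [p] and [q]. The first clause is the
    relation of K_3; the other two are what the braid relation gives, for right and for left
    multiplication: a common eigenvector with distinct eigenvalues is zero. No eigenvalue appears,
    so the arguments are uniform in the colors. *)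
Definition braided p q :=
  [/\ forall x y, p x * q y - p y * q x = q y * p x - q x * p y,
      forall v x y, x <> y -> v * p x = v -> v * q y = v -> v = 0
    & forall v x y, x <> y -> p x * v = v -> q y * v = v -> v = 0].

Lemma resolution_sum p x y z : resolution p -> rainbow x y z -> p x + p y + p z = 1.
Proof. by move=> [p1 _ _] /rainbow_sum->. Qed.

Lemma braided_sym p q : braided p q -> braided q p.
Proof.
case=> F1 Fr Fl; split.
- by move=> x y; rewrite -[LHS]opprB -F1 opprB.
- by move=> v x y xy vx vy; apply: (Fr v y x) => // /esym.
- by move=> v x y xy vx vy; apply: (Fl v y x) => // /esym.
Qed.

(** Multiplying the first clause of [braided] for [z], [y] by [p x] on the left and [p z] on the
    right kills every term but one. *)
Lemma braided_rainbow p q x y z : resolution p -> braided p q ->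
  rainbow x y z -> p x * q y * p z = 0.
Proof.
move=> [_ pp p0] [F1 _ _] [xy yz xz].
have /(congr1 (fun u => p x * u * p z)) := F1 z y.
rewrite !mulrBr !mulrBl !mulrA !(p0 x) // !mul0r subrr -!mulrA pp (p0 y z) //.
by rewrite !mulr0 subr0.
Qed.

(** Here [p], [q], [r] belong to three consecutive generators. The product turns out to be fixed on
    the left by both [q x] and [r z], which the braid relation forbids for a nonzero element. An
    auxiliary product with four factors is killed first, by the same argument on the right. *)
Lemma rainbow_vanish p q r x y z :
    resolution p -> resolution q -> resolution r ->
    braided p q -> braided q r -> (forall i j, p i * r j = r j * p i) ->
  rainbow x y z -> p x * q y * r z = 0.
Proof.
move=> resp resq resr pq qr pr.
have [[_ pp p0] [_ qq q0] [_ rr r0]] := And3 resp resq resr.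
have [[F1 Fr Fl] [G1 Gr Gl]] := (pq, qr).
(* A vector of the right ideal of W on which two adjacent generators act by distinct scalars is zero by the braid
   relation. *)
have H u v w : rainbow u v w -> p u * q v * p u * r w = 0.
  move=> uvw; have [uv vw uw] := uvw.
  have vwu : rainbow v w u by split=> // /esym.
  pose W := p u * q v * r w.
  have Wr : W * r w = W by rewrite -mulrA rr.
  have Wq : W * q u = 0.
    by rewrite /W -!mulrA [q v * _]mulrA (braided_rainbow resq qr) ?mulr0.
  have Wp : W * p w = 0.
    by rewrite /W -mulrA -pr mulrA (braided_rainbow resp pq) ?mul0r.
  have WE : p u * q v * p u * r w = W * p u by rewrite -!mulrA pr.
  have Wpq : W * p u * q w = 0.
    have E : W * p u * q w = W * q w * p u.
      have /(congr1 (fun t => W * t)) := F1 u w.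
      by rewrite !mulrBr !mulrA Wp Wq !mul0r !subr0.
    by apply: (Fr _ u w) => //; [rewrite E -mulrA pp | rewrite -mulrA qq].
  have Wqr t : t <> w -> W * p u * q t = 0.
    move=> tw; have Wprw : W * p u * r w = W * p u by rewrite -mulrA pr mulrA Wr.
    have Wprt : W * p u * r t = 0.
      by rewrite -mulrA pr mulrA -(mulrA _ (r w)) r0 ?mulr0 ?mul0r => [|/esym].
    apply: (Gr _ t w) => //; first by rewrite -mulrA qq.
    have /(congr1 (fun t => W * p u * t)) := G1 t w.
    by rewrite !mulrBr !mulrA Wpq Wprw Wprt !mul0r !subr0.
  by rewrite WE -[LHS]mulr1 -(resolution_sum resq uvw) !mulrDr Wpq !Wqr ?addr0.
move=> xyz; have [xy yz xz] := xyz.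
(* When the product is resolved on the right along [p], [H] kills the term of color [x] and
   [braided_rainbow] that of color [z]. *)
have Wpy : p x * q y * r z * p y = p x * q y * r z.
  have xzy : rainbow x z y by split=> // /esym.
  rewrite -[RHS]mulr1 -(resolution_sum resp xyz) !mulrDr -!mulrA -!pr !mulrA.
  by rewrite H // add0r [X in _ + X](_ : _ = 0) ?addr0 // (braided_rainbow resp) ?mul0r.
(* The relation for [x], [y] brings [q x] to the front, once [H] and orthogonality have removed two
   of its terms. *)
have WE : p x * q y * r z = - (q x * r z * p y).
  have yxz : rainbow y x z by split=> // /esym.
  have := congr1 (fun t => t * r z * p y) (F1 x y).
  rewrite !mulrBl Wpy.
  have -> : p y * q x * r z * p y = 0 by rewrite -mulrA -pr mulrA H.
  have -> : q y * p x * r z * p y = 0.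
    by rewrite -(mulrA _ (r z)) -pr -mulrA (mulrA (p x)) p0 // mul0r mulr0.
  by rewrite subr0 sub0r => ->; rewrite -(mulrA _ (p y)) pr mulrA -!mulrA pp.
apply: (Gl _ x z) => //; first by rewrite WE mulrN !mulrA qq.
rewrite -[RHS]mul1r -(resolution_sum resr xyz) !mulrDl.
rewrite [r y * _](_ : _ = 0) ?addr0; last first.
  have yxz : rainbow y x z by split=> // /esym.
  by rewrite WE mulrN !mulrA (braided_rainbow resr (braided_sym qr) yxz) mul0r oppr0.
rewrite [r x * _](_ : _ = 0) ?add0r //.
by rewrite !mulrA -pr -!mulrA [r x * _]mulrA (braided_rainbow resr (braided_sym qr)) ?mulr0.
Qed.

(** Moves the third generator one strand further away. Each [p x * q y * u z * r t] vanishes: for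
    [t = z] by commuting [u z] to the front, and otherwise because it is fixed on the right by [r t]
    and by [u z]. *)
Lemma rainbow_vanish_step p q r u x y z :
    resolution r -> resolution u -> braided r u ->
    (forall i j, p i * u j = u j * p i) -> (forall i j, q i * u j = u j * q i) ->
    rainbow x y z -> p x * q y * r z = 0 -> p x * q y * u z = 0.
Proof.
move=> resr [_ uu u0] ru pu qu xyz W0; have [xy yz xz] := xyz.
have [F1 Fr _] := ru.
set W := p x * q y * u z.
have Wr : W * r z = 0.
  by rewrite /W -(mulrA (p x)) qu mulrA pu -!mulrA (mulrA (p x)) W0 mulr0.
have Wrt t : t <> z -> W * r t = 0.
  move=> tz; apply: (Fr _ t z) => //.
    by rewrite -mulrA; case: resr => _ ->.
  have /(congr1 (fun s => W * s)) := F1 t z.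
  rewrite !mulrBr !mulrA Wr mul0r subr0 => ->.
  have -> : W * u z = W by rewrite /W -mulrA uu.
  have -> : W * u t = 0 by rewrite /W -mulrA u0 ?mulr0 // => /esym.
  by rewrite mul0r subr0.
by rewrite -[LHS]mulr1 -(resolution_sum resr xyz) !mulrDr Wr !Wrt ?addr0.
Qed.

End Resolutions.

Section SpectralProjectors.
Variables (K : fieldType) (A : algType K) (a b c : K).
Implicit Types x y v : A.

Definition ev (t : color) : K :=
  match t with Red => a | Green => b | Blue => c end.
Definition esum (t : color) : K :=
  match t with Red => b + c | Green => a + c | Blue => a + b end.
Definition eprod (t : color) : K :=
  match t with Red => b * c | Green => a * c | Blue => a * b end.
Definition eden (t : color) : K :=
  match t with
  | Red => (a - b) * (a - c)
  | Green => (b - a) * (b - c)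
  | Blue => (c - a) * (c - b)
  end.

(** Lagrange interpolation at the three eigenvalues: [esum t] and [eprod t] are the sum and product
    of the two eigenvalues other than [ev t], and [eden t] is the value at [ev t] of the monic
    quadratic that vanishes at those two. *)
Definition proj x t : A := (eden t)^-1 *: (x ^+ 2 - esum t *: x + eprod t *: 1).

Definition cubic_root x := (x - a *: 1) * (x - b *: 1) * (x - c *: 1) = 0.

(** Since [A] is not commutative, identities between polynomials in a single [x] are proved by
    [ring] in [{poly K}], modulo [cubic], and transported by [horner_alg]. *)
Let lagrange t : {poly K} := 'X^2 - (esum t)%:P * 'X + (eprod t)%:P.
Let cubic : {poly K} := ('X - a%:P) * ('X - b%:P) * ('X - c%:P).

Lemma projE x t : proj x t = (eden t)^-1 *: horner_alg x (lagrange t).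
Proof.
rewrite /proj /lagrange rmorphD rmorphB rmorphXn rmorphM /= !horner_algX.
by rewrite !horner_algC mulr_algl.
Qed.

Lemma horner_cubic x q : cubic_root x -> horner_alg x (cubic * q) = 0.
Proof.
move=> x0; rewrite rmorphM !rmorphM !rmorphB /= horner_algX !horner_algC.
by rewrite [X in X * _]x0 mul0r.
Qed.

Lemma cubicE x : cubic_root x ->
  x ^+ 3 = (a + b + c) *: x ^+ 2 - (a * b + a * c + b * c) *: x + (a * b * c) *: 1.
Proof.
move=> x0; rewrite -[in LHS](horner_algX x) -rmorphXn /=.
have -> : 'X^3 = cubic * 1 + ((a + b + c)%:P * 'X^2 - (a * b + a * c + b * c)%:P * 'X
    + (a * b * c)%:P) by rewrite /cubic !(polyCD, polyCM); ring.
rewrite rmorphD /= horner_cubic // add0r rmorphD rmorphB !rmorphM /= -?rmorphXn /=.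
by rewrite ?horner_algX !horner_algC !mulr_algl -expr2 mulr_algr !scalerA [c * _]mulrC.
Qed.

Hypotheses (a_neq0 : a != 0) (b_neq0 : b != 0) (c_neq0 : c != 0).
Hypothesis abc_distinct : (a - b) * (a - c) * (b - c) != 0.

Lemma ev_neq0 t : ev t != 0. Proof. by case: t. Qed.

Lemma ev_inj t u : t <> u -> ev t != ev u.
Proof.
move: abc_distinct; rewrite !mulf_eq0 !subr_eq0 !negb_or -andbA => /and3P[ab ac bc].
by case: t; case: u => //= _; rewrite // eq_sym.
Qed.

Lemma eden_neq0 t : eden t != 0.
Proof.
move: abc_distinct; rewrite !mulf_eq0 !subr_eq0 !negb_or -andbA => /and3P[ab ac bc].
by case: t; rewrite /= mulf_neq0 // subr_eq0 // eq_sym.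
Qed.

Lemma proj_resolution x : cubic_root x -> resolution (proj x).
Proof.
move=> x0; split.
- have -> : 1 = ((a - b) * (a - c) * (b - c))^-1 *: horner_alg x
    ((b - c)%:P * lagrange Red - (a - c)%:P * lagrange Green + (a - b)%:P * lagrange Blue).
    have -> : (b - c)%:P * lagrange Red - (a - c)%:P * lagrange Green
      + (a - b)%:P * lagrange Blue = ((a - b) * (a - c) * (b - c))%:P.
      by rewrite /lagrange /= !(polyCD, polyCN, polyCM); ring.
    by rewrite horner_algC scalerA mulVf // scale1r.
  rewrite rmorphD rmorphB !rmorphM /= !horner_algC !mulr_algl scalerDr scalerBr !scalerA.
  rewrite !projE -scaleNr; move: abc_distinct (eden_neq0 Red) (eden_neq0 Green) (eden_neq0 Blue).
  rewrite /= !mulf_eq0 !negb_or => /andP[/andP[ab ac] bc] _ /andP[ba _] /andP[ca cb].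
  by congr (_ *: _ + _ *: _ + _ *: _); field; rewrite ?ab ?ac ?bc ?ba ?ca ?cb.
- move=> t; rewrite projE -scalerAl -scalerAr scalerA -rmorphM.
  have -> : lagrange t * lagrange t
      = (eden t)%:P * lagrange t + cubic * ('X + (ev t)%:P - (esum t)%:P).
    by rewrite /lagrange /cubic; case: t; rewrite /= !(polyCD, polyCN, polyCM); ring.
  rewrite rmorphD /= horner_cubic // addr0 rmorphM /= horner_algC mulr_algl scalerA.
  by rewrite -mulrA mulVf ?mulr1 // eden_neq0.
- move=> t u tu; rewrite !projE -scalerAl -scalerAr scalerA -rmorphM.
  suff [q ->] : exists q, lagrange t * lagrange u = cubic * q.
    by rewrite /= horner_cubic ?scaler0.
  (* The constant is the third eigenvalue, the common root of the two quadratics. *)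
  exists ('X - (a + b + c - ev t - ev u)%:P).
  by move: tu; rewrite /lagrange /cubic; case: t; case: u => //= _;
     rewrite /= !(polyCD, polyCN, polyCM); ring.
Qed.

Lemma mul_proj x t : cubic_root x -> x * proj x t = ev t *: proj x t.
Proof.
move=> x0; rewrite projE -scalerAr scalerA [ev t * _]mulrC -scalerA; congr (_ *: _).
apply/eqP; rewrite -subr_eq0 -{1}[x](horner_algX x) -rmorphM -mulr_algl.
rewrite -(horner_algC x) -rmorphM -rmorphB /= (_ : _ - _ = cubic * 1) ?horner_cubic //.
by rewrite /lagrange /cubic; case: t; rewrite /= !(polyCD, polyCN, polyCM); ring.
Qed.

Lemma proj_mul x t : cubic_root x -> proj x t * x = ev t *: proj x t.
Proof.
move=> x0; rewrite -mul_proj // projE -scalerAl -scalerAr; congr (_ *: _).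
by rewrite -{2 3}[x](horner_algX x) -!rmorphM mulrC.
Qed.

Lemma proj_comm x y t u : x * y = y * x -> proj x t * proj y u = proj y u * proj x t.
Proof.
move=> xy; suff H z : x * z = z * x -> proj x t * z = z * proj x t.
  apply: H; have yx : GRing.comm x y by [].
  rewrite /proj -scalerAl -scalerAr; congr (_ *: _).
  rewrite !(mulrDl, mulrDr, mulNr, mulrN) -!scalerAl -!scalerAr !(mulr1, mul1r).
  by rewrite xy expr2 mulrA xy -!mulrA xy.
move=> xz; rewrite /proj -scalerAl -scalerAr; congr (_ *: _).
rewrite !(mulrDl, mulrDr, mulNr, mulrN) -!scalerAl -!scalerAr !(mulr1, mul1r).
by rewrite xz expr2 -mulrA xz mulrA xz mulrA.
Qed.

Let com x y := x * y - y * x.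

Let comDl x y v : com (x + y) v = com x v + com y v.
Proof. by rewrite /com mulrDl mulrDr opprD addrACA. Qed.
Let comZl k x v : com (k *: x) v = k *: com x v.
Proof. by rewrite /com -scalerAl -scalerAr scalerBr. Qed.
Let comDr x y v : com v (x + y) = com v x + com v y.
Proof. by rewrite /com mulrDl mulrDr opprD addrACA. Qed.
Let comZr k x v : com v (k *: x) = k *: com v x.
Proof. by rewrite /com -scalerAl -scalerAr scalerBr. Qed.
Let com1l x : com 1 x = 0. Proof. by rewrite /com mul1r mulr1 subrr. Qed.
Let com1r x : com x 1 = 0. Proof. by rewrite /com mul1r mulr1 subrr. Qed.

(** The relator says [com x (y ^+ 2) = com (x ^+ 2) y], which makes the commutator of [proj x t] and
    [proj y u] symmetric in [t] and [u]. On a common eigenvector the two sides of the braid relation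
    act by [ev t * ev t * ev u] and [ev t * ev u * ev u], which differ. *)
Lemma proj_braided x y : cubic_root x -> cubic_root y ->
    x * y * x = y * x * y ->
    y ^+ 2 * x - x * y ^+ 2 - y * x ^+ 2 + x ^+ 2 * y = 0 ->
  braided (proj x) (proj y).
Proof.
move=> x0 y0 xyx R0; split.
- have comE t u : com (proj x t) (proj y u) = ((eden t)^-1 * (eden u)^-1) *:
    (com (x ^+ 2) (y ^+ 2) - (esum t + esum u) *: com (x ^+ 2) y
     + (esum t * esum u) *: com x y).
    have comE2 : com x (y ^+ 2) = com (x ^+ 2) y.
      apply/eqP; rewrite eq_sym /com -subr_eq0 -[X in _ == X]R0 opprB addrC; apply/eqP.
      by rewrite [x ^+ 2 * y + _]addrC addrA.
    rewrite comZl comZr scalerA !(comDl, comDr) -!scaleNr !(comZl, comZr, com1l, com1r).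
    rewrite !scaler0 !addr0 comE2 scalerA mulrNN opprD scalerDl.
    by rewrite -!addrA (addrCA (- esum u *: _)).
  move=> t u; have /eqP : com (proj x t) (proj y u) = com (proj x u) (proj y t).
    by rewrite !comE [esum u + _]addrC [esum u * _]mulrC [_^-1 * _]mulrC.
  rewrite /com subr_eq => /eqP->.
  by rewrite addrC !addrA addNr add0r addrC.
- move=> v t u tu vx vy.
  have vxE : v * x = ev t *: v by rewrite -vx -mulrA proj_mul // -scalerAr.
  have vyE : v * y = ev u *: v by rewrite -vy -mulrA proj_mul // -scalerAr.
  have /(congr1 (fun w => v * w)) := xyx.
  rewrite !mulrA !(vxE, vyE, =^~ scalerAl, scalerA) => /eqP.
  rewrite -subr_eq0 -scalerBl scaler_eq0 => /orP[|/eqP//].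
  rewrite (_ : _ - _ = ev t * ev u * (ev t - ev u)); last by ring.
  by rewrite !mulf_eq0 (negPf (ev_neq0 t)) (negPf (ev_neq0 u)) subr_eq0 (negPf (ev_inj tu)).
- move=> v t u tu vx vy.
  have vxE : x * v = ev t *: v by rewrite -vx mulrA mul_proj // -scalerAl.
  have vyE : y * v = ev u *: v by rewrite -vy mulrA mul_proj // -scalerAl.
  have /(congr1 (fun w => w * v)) := xyx.
  rewrite -!mulrA !(vxE, vyE, =^~ scalerAr, scalerA) => /eqP.
  rewrite -subr_eq0 -scalerBl scaler_eq0 => /orP[|/eqP//].
  rewrite (_ : _ - _ = ev t * ev u * (ev t - ev u)); last by ring.
  by rewrite !mulf_eq0 (negPf (ev_neq0 t)) (negPf (ev_neq0 u)) subr_eq0 (negPf (ev_inj tu)).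
Qed.

End SpectralProjectors.

(** * The spanning family *)

Section SubalgebraClosure.
Variables (K : fieldType) (A : algType K) (X : A -> Prop).
Local Notation B := (subalg_gen X).

Lemma subalg_gen0 : B 0.
Proof. by rewrite -(scale0r 1); apply/subalg_genZ/subalg_gen1. Qed.

Lemma subalg_genN x : B x -> B (- x).
Proof. by rewrite -scaleN1r; apply: subalg_genZ. Qed.

Lemma subalg_genB x y : B x -> B y -> B (x - y).
Proof. by move=> Bx By; apply/subalg_genD/subalg_genN. Qed.

Lemma subalg_genX2 x : B x -> B (x ^+ 2).
Proof. by move=> Bx; rewrite expr2; apply: subalg_genM. Qed.

Lemma subalg_gen_sub (Y : A -> Prop) x : (forall y, X y -> subalg_gen Y y) ->
  B x -> subalg_gen Y x.
Proof.
move=> XY; elim=> {x} [|x /XY|x y _ ? _ ?|k x _ ?|x y _ ? _ ?] //.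
- exact: subalg_gen1.
- exact: subalg_genD.
- exact: subalg_genZ.
- exact: subalg_genM.
Qed.

Lemma subalg_gen_proj a b c x t : B x -> B (proj a b c x t).
Proof.
move=> Bx; apply/subalg_genZ/subalg_genD; last exact/subalg_genZ/subalg_gen1.
by apply: subalg_genB; [exact: subalg_genX2 | exact: subalg_genZ].
Qed.

(** The left [B]-submodule generated by [Y]; its stability under right multiplication is a separate
    question, settled below for the family of the theorem. *)
Inductive lspan (Y : A -> Prop) : A -> Prop :=
| lspan0 : lspan Y 0
| lspanG x y of B x & Y y : lspan Y (x * y)
| lspanD x y of lspan Y x & lspan Y y : lspan Y (x + y).

Lemma lspanMl Y x y : B x -> lspan Y y -> lspan Y (x * y).
Proof.
move=> Bx; elim=> {y} [|z y Bz Yy|y z _ IHy _ IHz].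
- by rewrite mulr0; apply: lspan0.
- by rewrite mulrA; apply: lspanG => //; apply: subalg_genM.
- by rewrite mulrDr; apply: lspanD.
Qed.

Lemma lspanZ Y k y : lspan Y y -> lspan Y (k *: y).
Proof.
by move=> Yy; rewrite -mulr_algl; apply: lspanMl => //; apply/subalg_genZ/subalg_gen1.
Qed.

Lemma lspanN Y y : lspan Y y -> lspan Y (- y).
Proof. by rewrite -scaleN1r; apply: lspanZ. Qed.

Lemma lspanB Y x y : lspan Y x -> lspan Y y -> lspan Y (x - y).
Proof. by move=> Yx Yy; apply/lspanD/lspanN. Qed.

Lemma lspan_mem Y y : Y y -> lspan Y y.
Proof. by move=> Yy; rewrite -[y]mul1r; apply: lspanG => //; apply: subalg_gen1. Qed.

Lemma lspan_trans (Y Z : A -> Prop) z x : (forall y, Y y -> lspan Z (y * z)) ->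
  lspan Y x -> lspan Z (x * z).
Proof.
move=> YZ; elim=> {x} [|x y Bx Yy|x y _ IHx _ IHy].
- by rewrite mul0r; apply: lspan0.
- by rewrite -mulrA; apply/lspanMl/YZ.
- by rewrite mulrDl; apply: lspanD.
Qed.

Lemma lspan_sub (Y Z : A -> Prop) x : (forall y, Y y -> Z y) -> lspan Y x -> lspan Z x.
Proof.
move=> YZ; rewrite -[x in lspan Z x]mulr1; apply: lspan_trans => y Yy.
by rewrite mulr1; apply/lspan_mem/YZ.
Qed.

End SubalgebraClosure.

Section Spanning.
Variables (K : fieldType) (A : algType K) (a b c : K).
Hypotheses (a_neq0 : a != 0) (b_neq0 : b != 0) (c_neq0 : c != 0).
Hypothesis abc_distinct : (a - b) * (a - c) * (b - c) != 0.
Variables (s : nat -> A) (m : nat).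

(** The relations of K_m imposed at every index, for a sequence in any algebra, so that the argument
    for K_n can run inside a larger algebra. The presentation has the cubic relation only at index 1
    and the last relation only at indices 1 and 2. *)
Definition cubic_system : Prop :=
  [/\ forall i, (0 < i < m)%N -> cubic_root a b c (s i),
      forall i, (0 < i)%N -> (i.+1 < m)%N -> s i * s i.+1 * s i = s i.+1 * s i * s i.+1,
      forall i j, (0 < i)%N -> (i.+1 < j < m)%N -> s i * s j = s j * s i
    & forall i, (0 < i)%N -> (i.+1 < m)%N ->
        s i.+1 ^+ 2 * s i - s i * s i.+1 ^+ 2 - s i.+1 * s i ^+ 2 + s i ^+ 2 * s i.+1 = 0].

Hypothesis s_system : cubic_system.

Let s_cubic := let: And4 h _ _ _ := s_system in h.
Let s_braid := let: And4 _ h _ _ := s_system in h.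
Let s_comm := let: And4 _ _ h _ := s_system in h.
Let s_rel := let: And4 _ _ _ h := s_system in h.

Local Notation ev := (ev a b c).
Local Notation P i := (proj a b c (s i)).

Definition gen_subalg (n : nat) : A -> Prop :=
  subalg_gen (fun x => exists2 i, (0 < i < n)%N & x = s i).

Lemma gen_subalg_gen n i : (0 < i < n)%N -> gen_subalg n (s i).
Proof. by move=> in_; apply: subalg_genX; exists i. Qed.

Let P_res i : (0 < i < m)%N -> resolution (P i).
Proof. by move=> im; apply: proj_resolution => //; apply: s_cubic. Qed.

Let P_braided i : (0 < i)%N -> (i.+1 < m)%N -> braided (P i) (P i.+1).
Proof.
move=> i0 im; apply: proj_braided => //; try (apply: s_cubic; lia).
  exact: s_braid.
exact: s_rel.
Qed.

Let P_comm i j t u : (0 < i)%N -> (i.+1 < j < m)%N -> P i t * P j u = P j u * P i t.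
Proof. by move=> i0 ij; apply: proj_comm; apply: s_comm. Qed.

(** Induction on [k], starting from three consecutive generators. *)
Lemma rainbow_far i k x y z : (0 < i)%N -> (i.+1 < k < m)%N -> rainbow x y z ->
  P i x * P i.+1 y * P k z = 0.
Proof.
move=> i0 /andP[]; elim: k => // k IHk ik km xyz.
have [ik'|ik'] := ltnP i.+1 k.
  apply: (rainbow_vanish_step (r := P k)) => //; try (apply: P_res; lia);
    last by apply: IHk => //; lia.
  - by apply: P_braided; lia.
  - by move=> t u; apply: P_comm; lia.
  - by move=> t u; apply: P_comm; lia.
have -> : k = i.+1 by lia.
apply: rainbow_vanish => //; try (apply: P_res; lia); try (apply: P_braided; lia).
by move=> t u; apply: P_comm; lia.
Qed.

(** In the relation between [P i] and [P i.+1], multiplied by [P i.+1 y] on the left and [P k z] on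
    the right, one side vanishes by [rainbow_far] and only this product survives on the other. *)
Lemma rainbow_far_rev i k x y z : (0 < i)%N -> (i.+1 < k < m)%N -> rainbow x y z ->
  P i.+1 y * P i x * P k z = 0.
Proof.
move=> i0 ik xyz; have [xy yz xz] := xyz.
have [F1 _ _] := P_braided i0 (ltac:(lia) : (i.+1 < m)%N).
have [_ qq q0] := P_res (ltac:(lia) : (0 < i.+1 < m)%N).
have /(congr1 (fun v => P i.+1 y * v * P k z)) := F1 x y.
rewrite !mulrBr !mulrBl -!mulrA !(mulrA (P i _)) rainbow_far //.
rewrite (rainbow_far i0 ik (x := y)); last by split=> // /esym.
by rewrite mulr0 subrr (mulrA _ (P i.+1 y)) qq (mulrA _ (P i.+1 x)) q0 ?mul0r ?subr0 // => /esym.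
Qed.


Let s_relE i : (0 < i)%N -> (i.+1 < m)%N ->
  s i.+1 * s i ^+ 2 = s i.+1 ^+ 2 * s i - s i * s i.+1 ^+ 2 + s i ^+ 2 * s i.+1.
Proof.
move=> i0 im; apply/eqP; rewrite eq_sym -subr_eq0 -[X in _ == X](s_rel i0 im); apply/eqP.
exact: addrAC.
Qed.

(** After [s_relE], the braid relation brings a power of [s i] to the front of every term. This is
    what pushing [s (n - k)] through [desc2 k.+1] requires. *)
Let s_sandwich i : (0 < i)%N -> (i.+1 < m)%N -> s i.+1 * s i ^+ 2 * s i.+1 =
  s i * (s i.+1 * s i ^+ 2) - s i * s i.+1 ^+ 3 + s i ^+ 2 * s i.+1 ^+ 2.
Proof.
move=> i0 im; have bE := s_braid i0 im.
rewrite [in LHS]s_relE // mulrDl mulrBl; congr (_ - _ + _).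
- by rewrite !expr2 -!mulrA (mulrA (s i.+1) (s i) (s i.+1)) -bE !mulrA -bE -!mulrA.
- by rewrite (exprSr _ 2) mulrA.
- by rewrite -mulrA -expr2.
Qed.

Section Level.
Variable n : nat.
Hypothesis n_gt0 : (0 < n)%N.
Hypothesis n_lt : (n < m)%N.

Local Notation B := (gen_subalg n).
Local Notation span := (@lspan K A (fun x => exists2 i, (0 < i < n)%N & x = s i)).

(* [desc k] is s_{n,k}, while [desc2 k] is x_{n,k+1}. *)
Definition desc k : A := \prod_(0 <= j < k) s (n - j).
Definition desc2 k : A := desc k * s (n - k) ^+ 2.

Definition descs k (x : A) : Prop := exists2 l, (l <= k)%N & x = desc l.
Definition all_descs (x : A) : Prop :=
  descs n x \/ exists2 k, (k < n)%N & x = desc2 k.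

Lemma desc0 : desc 0 = 1.
Proof. by rewrite /desc big_geq. Qed.

Lemma descS k : desc k.+1 = desc k * s (n - k).
Proof. by rewrite /desc big_nat_recr. Qed.

Lemma desc_comm k j : (0 < j)%N -> (j < n - k)%N -> desc k * s j = s j * desc k.
Proof.
elim: k => [|k IHk] j0 jk; first by rewrite desc0 mulr1 mul1r.
by rewrite descS -mulrA -s_comm ?mulrA ?IHk //; lia.
Qed.

Lemma desc_shift k j : (k <= n)%N -> (n - k < j.-1)%N -> (j <= n)%N ->
  desc k * s j = s j.-1 * desc k.
Proof.
elim: k => [|k IHk] kn kj jn; first by lia.
rewrite descS; have [kj'|kj'] := ltnP (n - k) j.-1.
  by rewrite -mulrA s_comm ?mulrA ?IHk //; lia.
case: k => [|k] in IHk kn kj kj' *; first by lia.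
have jE : j = (n - k.+1).+1 by lia.
rewrite jE descS (_ : n - k = (n - k.+1).+1)%N /=; last by lia.
rewrite -mulrA -mulrA (mulrA (s _.+1)) -s_braid; try lia.
by rewrite !mulrA desc_comm //=; lia.
Qed.

Lemma desc2_comm k j : (0 < j)%N -> (j.+1 < n - k)%N -> desc2 k * s j = s j * desc2 k.
Proof.
move=> j0 jk; have sc : s (n - k) * s j = s j * s (n - k) by apply/esym/s_comm; lia.
by rewrite /desc2 expr2 -!mulrA sc (mulrA (s (n - k))) sc !mulrA desc_comm //; lia.
Qed.

(** The relation of K_3 becomes a recursion: up to a left multiple of [desc k.+1], the next [desc2]
    is the commutator of the previous one with a generator. It serves both for right multiplication
    and for the eigenvalue statement [proj_desc2_eigen]. *)
Lemma desc2_prev k : (k.+1 < n)%N -> desc2 k.+1 =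
  desc2 k * s (n - k.+1) - s (n - k.+1) * desc2 k + s (n - k.+1) ^+ 2 * desc k.+1.
Proof.
move=> kn; have skE : (n - k = (n - k.+1).+1)%N by lia.
have Ds : desc k * s (n - k.+1) = s (n - k.+1) * desc k by rewrite desc_comm //; lia.
have Dsx x : desc k * (s (n - k.+1) * x) = s (n - k.+1) * (desc k * x).
  by rewrite !mulrA Ds.
rewrite /desc2 descS skE -!(mulrA (desc k)) s_relE; try lia.
by rewrite mulrDr mulrBr Dsx expr2 -!(mulrA (s (n - k.+1))) !Dsx.
Qed.

Lemma desc2_shift k j : (k < n)%N -> (n - k < j.-1)%N -> (j <= n)%N ->
  desc2 k * s j = s j.-1 * desc2 k.
Proof.
move=> kn kj jn; have sc : s (n - k) * s j = s j * s (n - k) by rewrite s_comm //; lia.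
rewrite /desc2 expr2 -!mulrA sc (mulrA (s (n - k))) sc !mulrA desc_shift //; lia.
Qed.

Lemma desc2_shift_near k : (k.+1 < n)%N -> desc2 k.+1 * s (n - k) =
  s (n - k.+1) * desc2 k.+1 - s (n - k.+1) * (desc k * s (n - k) ^+ 3)
  + s (n - k.+1) ^+ 2 * desc2 k.
Proof.
move=> kn; have skE : (n - k = (n - k.+1).+1)%N by lia.
have Ds : desc k * s (n - k.+1) = s (n - k.+1) * desc k by rewrite desc_comm //; lia.
have Dsx x : desc k * (s (n - k.+1) * x) = s (n - k.+1) * (desc k * x).
  by rewrite !mulrA Ds.
rewrite /desc2 descS skE -!(mulrA (desc k)) s_sandwich; try lia.
by rewrite mulrDr mulrBr expr2 -!(mulrA (s (n - k.+1))) !Dsx.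
Qed.

Lemma descs_mul k x : (k < n)%N -> descs k x -> span (descs k.+1) (x * s (n - k)).
Proof.
move=> kn [l lk ->]; have [lk'|lk'] := ltnP l k.
  rewrite desc_comm; try lia.
  by apply: lspanG; [apply: gen_subalg_gen; lia | exists l => //; lia].
by have -> : k = l by [lia]; rewrite -descS; apply: lspan_mem; exists l.+1.
Qed.

Lemma all_descs_desc k : (k <= n)%N -> span all_descs (desc k).
Proof. by move=> kn; apply: lspan_mem; left; exists k. Qed.

Lemma all_descs_desc2 k : (k < n)%N -> span all_descs (desc2 k).
Proof. by move=> kn; apply: lspan_mem; right; exists k. Qed.

Lemma desc_cubic k : (k < n)%N -> span all_descs (desc k * s (n - k) ^+ 3).
Proof.
move=> kn; rewrite (@cubicE _ _ a b c); last by apply: s_cubic; lia.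
rewrite mulrDr mulrBr -!scalerAr mulr1 -descS.
apply: lspanD; last exact/lspanZ/all_descs_desc/ltnW.
by apply: lspanB; apply: lspanZ; [exact: all_descs_desc2 | exact: all_descs_desc].
Qed.

(** Generators far below [n - k] commute with the family, those far above come out on the left with
    index lowered by one. The near ones lengthen a [desc], square its last letter, cube it (reduced
    by the cubic relation), or call for [desc2_prev] and [desc2_shift_near]. *)
Lemma all_descs_mul x j : (0 < j <= n)%N -> all_descs x -> span all_descs (x * s j).
Proof.
move=> jn [] [k kn ->].
- have [kj|kj|kj] := ltngtP j (n - k).
  + rewrite desc_comm; try lia.
    by apply: lspanMl; [apply: gen_subalg_gen; lia | exact: all_descs_desc].
  + case: k => [|k] in kn kj *; first by lia.
    have [->|jk] := eqVneq j (n - k)%N.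
      by rewrite descS -mulrA -expr2; apply: all_descs_desc2.
    rewrite desc_shift; try lia.
    by apply: lspanMl; [apply: gen_subalg_gen; lia | exact: all_descs_desc].
  + by rewrite kj -descS; apply: all_descs_desc; lia.
have [kj|kj|->] := ltngtP j (n - k).
- have [jk|jk] := ltnP j.+1 (n - k).
    rewrite desc2_comm; try lia.
    by apply: lspanMl; [apply: gen_subalg_gen; lia | exact: all_descs_desc2].
  have kn' : (k.+1 < n)%N by lia.
  have -> : j = (n - k.+1)%N by lia.
  have -> : desc2 k * s (n - k.+1) = s (n - k.+1) * desc2 k + desc2 k.+1
      - s (n - k.+1) ^+ 2 * desc k.+1.
    by rewrite desc2_prev // addrA addrK addrC subrK.
  have Bs : B (s (n - k.+1)) by apply: gen_subalg_gen; lia.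
  apply: lspanB; last by apply: lspanMl; [exact: subalg_genX2 | exact: all_descs_desc].
  by apply: lspanD; [apply: lspanMl => // |]; exact: all_descs_desc2.
- case: k => [|k] in kn kj *; first by lia.
  have Bs : B (s (n - k.+1)) by apply: gen_subalg_gen; lia.
  have [->|jk] := eqVneq j (n - k)%N.
    rewrite desc2_shift_near //; apply: lspanD; [apply: lspanB|].
    + by apply: lspanMl => //; apply: all_descs_desc2.
    + by apply: lspanMl => //; apply: desc_cubic; lia.
    + by apply: lspanMl; [exact: subalg_genX2 | apply: all_descs_desc2; lia].
  rewrite desc2_shift; try lia.
  by apply: lspanMl; [apply: gen_subalg_gen; lia | exact: all_descs_desc2].
- by rewrite /desc2 -mulrA -exprSr; apply: desc_cubic.
Qed.

Lemma span_all_descs x : gen_subalg n.+1 x -> span all_descs x.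
Proof.
move=> Bx; rewrite -[x]mul1r; have : span all_descs 1.
  by rewrite -desc0; apply: all_descs_desc.
(* Generalizing 1 to any element of the span lets the induction pass through products. *)
move: (1 : A); elim: Bx => {x} [|_ [i im ->]|x y _ IHx _ IHy|k x _ IHx|x y _ IHx _ IHy] v Tv.
- by rewrite mulr1.
- by apply: lspan_trans Tv => y; apply: all_descs_mul; lia.
- by rewrite mulrDr; apply: lspanD; [exact: IHx | exact: IHy].
- by rewrite -scalerAr; apply/lspanZ/IHx.
- by rewrite mulrA; apply/IHy/IHx.
Qed.

Let B_proj i t : (0 < i < n)%N -> B (P i t).
Proof. by move=> im; apply/subalg_gen_proj/gen_subalg_gen. Qed.

Let proj_sum i t : (0 < i < m)%N ->
  exists u v, [/\ t <> u, t <> v & P i t + P i u + P i v = 1].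
Proof.
move=> im; have [u tu] : exists u, t <> u by case: t; [exists Green|exists Red|exists Red].
have [v tuv] := rainbow_complete tu; exists u, v; split=> //; first by case: tuv.
by apply: resolution_sum tuv; apply: P_res.
Qed.

Let desc2_0 : desc2 0 = s n ^+ 2.
Proof. by rewrite /desc2 desc0 mul1r subn0. Qed.

(** The hypothesis is a quadratic equation that expresses [w * s n ^+ 2] through [w * s n] and
    [w]. *)
Lemma span_desc2_0 w z : B w -> w * P n z = 0 -> span (descs 1) (w * desc2 0).
Proof.
move=> Bw; rewrite /proj -scalerAr => /eqP; rewrite scaler_eq0 invr_eq0.
rewrite (negPf (eden_neq0 abc_distinct z)) mulrDr mulrBr -desc2_0 => /eqP w0.
have d1 : desc 1 = s n by rewrite descS desc0 mul1r subn0.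
rewrite -[_ * _](subrK (w * (esum a b c z *: desc 1))).
have -> : w * desc2 0 - w * (esum a b c z *: desc 1) = - (w * (eprod a b c z *: desc 0)).
  by apply/eqP; rewrite -addr_eq0 desc0 d1 w0.
by apply: lspanD; [apply: lspanN|]; apply/lspanMl => //; apply: lspanZ;
   apply: lspan_mem; [exists 0%N | exists 1%N].
Qed.

(** By [rainbow_far_rev], the two projectors annihilate [P n z] for the remaining color [z]. *)
Lemma proj_desc2_0_far i t u : (0 < i)%N -> (i.+1 < n)%N -> t <> u ->
  span (descs 1) (P i.+1 t * P i u * desc2 0).
Proof.
move=> i0 im ut; have /rainbow_complete[z utz] : u <> t by move/esym.
apply: (span_desc2_0 (z := z)); first by apply: subalg_genM; apply: B_proj; lia.
by apply: rainbow_far_rev utz => //; lia.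
Qed.

(** Resolving [P i.+1 t] on the left along index [i.+2], and [P i.+2 t] on the right along index
    [i.+1], leaves the same term [P i.+2 t * P i.+1 t] modulo the span. *)
Lemma proj_desc2_0_congr i t : (0 < i < n)%N ->
  span (descs 1) (P 1 t * desc2 0 - P i t * desc2 0).
Proof.
elim: i => // -[_ _|i IHi im]; first by rewrite subrr; apply: lspan0.
rewrite -[P 1 t * _](subrK (P i.+1 t * desc2 0)) -addrA.
apply: lspanD; first by apply: IHi; lia.
have [u [v [tu tv Pi1]]] := @proj_sum i.+1 t (ltac:(lia)).
have [u' [v' [tu' tv' Pi2]]] := @proj_sum i.+2 t (ltac:(lia)).
have -> : P i.+1 t * desc2 0 = P i.+2 t * P i.+1 t * desc2 0
    + (P i.+2 u' * P i.+1 t * desc2 0 + P i.+2 v' * P i.+1 t * desc2 0).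
  by rewrite -!mulrA -!mulrDl addrA Pi2 mul1r.
have -> : P i.+2 t * desc2 0 = P i.+2 t * P i.+1 t * desc2 0
    + (P i.+2 t * P i.+1 u * desc2 0 + P i.+2 t * P i.+1 v * desc2 0).
  by rewrite -!mulrDl -!mulrDr addrA Pi1 mulr1.
rewrite opprD addrACA subrr add0r.
by apply: lspanB; apply: lspanD; apply: proj_desc2_0_far => // /esym.
Qed.

(** For [k = 0], [P 1 t] may be replaced by [P i t], on which [s i] acts by [ev t]. The induction
    step expands [desc2 k.+1] by [desc2_prev]. *)
Lemma proj_desc2_eigen k i t : (k < n)%N -> (0 < i < n)%N ->
  span (descs k.+1) ((s i - ev t *: 1) * P 1 t * desc2 k).
Proof.
move=> kn im; have n1 : (0 < 1 < n)%N by lia.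
have Bst j u : (0 < j < n)%N -> B (s j - ev u *: 1).
  by move=> jm; apply: subalg_genB; [exact: gen_subalg_gen | apply/subalg_genZ/subalg_gen1].
have Bw j u : (0 < j < n)%N -> B ((s j - ev u *: 1) * P 1 u).
  by move=> jm; apply: subalg_genM; [exact: Bst | exact: B_proj].
elim: k => [|k IHk] in i t kn im *.
  rewrite -mulrA -(subrK (P i t * desc2 0) (P 1 t * desc2 0)) mulrDr.
  apply: lspanD; first by apply: lspanMl; [exact: Bst | exact: proj_desc2_0_congr].
  rewrite mulrA mulrBl mul_proj ?mulr_algl ?subrr ?mul0r; first exact: lspan0.
  by apply: s_cubic; lia.
have S_in : (0 < n - k.+1 < n)%N by lia.
set w := _ * P 1 t; set S := s (n - k.+1).
have BS : B S by apply: gen_subalg_gen.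
have ww : B w by apply: Bw.
rewrite desc2_prev // mulrDr mulrBr; apply: lspanD; last first.
  do 2!apply: lspanMl => //; first exact: subalg_genX2.
  by apply: lspan_mem; exists k.+1.
apply: lspanB.
  rewrite mulrA; apply: lspan_trans (IHk i t (ltnW kn) im).
  by move=> y; apply: descs_mul.
have sub y : span (descs k.+1) y -> span (descs k.+2) y.
  by apply: lspan_sub => _ [l lk ->]; exists l => //; apply: leqW.
(* By induction [S] acts on [P 1 u * desc2 k] by [ev u] up to lower terms. Then [w * P 1 u] is zero
   by orthogonality unless [u = t], where the induction hypothesis applies again. *)
apply: sub; have Pw u : span (descs k.+1) (w * (S * (P 1 u * desc2 k))).
  have -> : S * (P 1 u * desc2 k)
      = (S - ev u *: 1) * P 1 u * desc2 k + ev u *: (P 1 u * desc2 k).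
    by rewrite -mulrA mulrBl mulr_algl subrK.
  rewrite mulrDr; apply: lspanD; first by apply: lspanMl => //; apply: IHk => //; apply: ltnW.
  rewrite -scalerAr; apply: lspanZ; rewrite mulrA.
  have [_ pp p0] := P_res (ltac:(lia) : (0 < 1 < m)%N).
  have [->|tu] := color_eq_dec u t.
    by rewrite /w -(mulrA _ (P 1 t) (P 1 t)) pp; apply: IHk => //; apply: ltnW.
  by rewrite /w -(mulrA _ (P 1 t) (P 1 u)) p0 ?mulr0 ?mul0r; [exact: lspan0 | move/esym].
have [p1 _ _] := P_res (ltac:(lia) : (0 < 1 < m)%N).
by rewrite -[desc2 k]mul1r -p1 !mulrDl !mulrDr; do 2!apply: lspanD => //.
Qed.

(** Acting by a scalar modulo the span is preserved by sums, scalings and products, so the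
    generators suffice. *)
Lemma desc2_scalar k t w : (1 < n)%N -> (k < n)%N -> B w ->
  exists z : K, span (descs k.+1) (w * (P 1 t * desc2 k) - z *: (P 1 t * desc2 k)).
Proof.
move=> n1 kn; elim=> {w} [|_ [i im ->]|x y _ [z Hz] _ [z' Hz']|l x _ [z Hz]|x y Bx [z Hz] _ [z' Hz']].
- by exists 1; rewrite mul1r scale1r subrr; apply: lspan0.
- exists (ev t); have := proj_desc2_eigen t kn im.
  by rewrite -mulrA mulrBl mulr_algl.
- by exists (z + z'); rewrite mulrDl scalerDl opprD addrACA; apply: lspanD.
- by exists (l * z); rewrite -scalerAl -scalerA -scalerBr; apply: lspanZ.
- exists (z' * z); set v := P 1 t * _ in Hz Hz' *.
  have -> : x * y * v - (z' * z) *: v = x * (y * v - z' *: v) + z' *: (x * v - z *: v).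
    by rewrite mulrBr -scalerAr scalerBr scalerA addrA subrK -(mulrA x y).
  by apply: lspanD; [exact: lspanMl | exact: lspanZ].
Qed.

(** This cuts the coefficients down from K_n to K_2: the new coefficient combines the projectors of
    [s 1] with the three scalars of [desc2_scalar]. *)
Lemma desc2_reduce k w : (1 < n)%N -> (k < n)%N -> B w ->
  exists2 v, gen_subalg 2 v & span (descs k.+1) (w * desc2 k - v * desc2 k).
Proof.
move=> n1 kn Bw; have [p1 _ _] := P_res (ltac:(lia) : (0 < 1 < m)%N).
have [z0 H0] := desc2_scalar Red n1 kn Bw.
have [z1 H1] := desc2_scalar Green n1 kn Bw.
have [z2 H2] := desc2_scalar Blue n1 kn Bw.
exists (z0 *: P 1 Red + z1 *: P 1 Green + z2 *: P 1 Blue).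
  by do 2?apply: subalg_genD; apply/subalg_genZ/subalg_gen_proj/gen_subalg_gen.
rewrite -{1}[desc2 k]mul1r -p1 !mulrDl !mulrDr -(scalerAl z0) -(scalerAl z1) -(scalerAl z2) !opprD.
by rewrite addrACA; apply: lspanD => //; rewrite addrACA; apply: lspanD.
Qed.

Lemma descs_sum k x : (k <= n)%N -> span (descs k) x ->
  exists2 f : nat -> A, forall l, B (f l) & x = \sum_(l < n.+1) f l * desc l.
Proof.
move=> kn; elim=> {x} [|x _ Bx [l lk ->]|x y _ [f Bf ->] _ [g Bg ->]].
- exists (fun=> 0) => [_|]; first exact: subalg_gen0.
  by rewrite big1 // => l _; rewrite mul0r.
- exists (fun j => if j == l then x else 0) => [j|].
    by case: eqP => // _; apply: subalg_gen0.
  have ln : (l < n.+1)%N by lia.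
  rewrite (bigD1 (Ordinal ln)) //= eqxx big1 ?addr0 // => j.
  by rewrite -val_eqE /= => /negPf->; rewrite mul0r.
- exists (fun l => f l + g l) => [l|]; first by apply: subalg_genD; [apply: Bf | apply: Bg].
  by rewrite -big_split; apply: eq_bigr => l _; rewrite mulrDl.
Qed.

(** The spanning half of the theorem; the summand K_n is the term of index 0, as [desc 0 = 1]. *)
Lemma gen_subalgS_sum x : (1 < n)%N -> gen_subalg n.+1 x ->
  exists f g : nat -> A, [/\ forall k, B (f k), forall k, gen_subalg 2 (g k)
    & x = \sum_(k < n.+1) f k * desc k + \sum_(k < n) g k * desc2 k].
Proof.
move=> n1 /span_all_descs; elim=> {x} [|x y Bx|x y _ [f [g [Bf Bg ->]]] _ [f' [g' [Bf' Bg' ->]]]].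
- exists (fun=> 0), (fun=> 0); split; try by move=> _; apply: subalg_gen0.
  by rewrite !big1 ?addr0 // => k _; rewrite mul0r.
- case=> [yn|[k kn ->]].
    have [f Bf ->] := descs_sum (leqnn n) (lspanG Bx yn).
    exists f, (fun=> 0); split=> // [_|]; first exact: subalg_gen0.
    by rewrite [X in _ + X]big1 ?addr0 // => k _; rewrite mul0r.
  have [v Bv /(descs_sum kn)[f Bf fE]] := desc2_reduce n1 kn Bx.
  exists f, (fun j => if j == k then v else 0); split=> // [j|].
    by case: eqP => // _; apply: subalg_gen0.
  rewrite -fE (bigD1 (Ordinal kn)) //= eqxx big1 ?addr0 ?subrK // => j.
  by rewrite -val_eqE /= => /negPf->; rewrite mul0r.
- exists (fun k => f k + f' k), (fun k => g k + g' k); split.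
  + by move=> k; apply: subalg_genD; [apply: Bf | apply: Bf'].
  + by move=> k; apply: subalg_genD; [apply: Bg | apply: Bg'].
  rewrite addrACA -!big_split.
  by congr (_ + _); apply: eq_bigr => k _; rewrite mulrDl.
Qed.

End Level.

End Spanning.

(** * Representations through the Hecke algebras *)

Section Representations.
Variables (K : fieldType) (V : lmodType K).

Record is_rep (A : algType K) (rho : A -> V -> V) : Prop := IsRep {
  repDl : forall x y v, rho (x + y) v = rho x v + rho y v;
  repZl : forall k x v, rho (k *: x) v = k *: rho x v;
  rep1 : forall v, rho 1 v = v;
  repM : forall x y v, rho (x * y) v = rho x (rho y v);
  repDr : forall x v w, rho x (v + w) = rho x v + rho x w;
  repZr : forall k x v, rho x (k *: v) = k *: rho x v }.

Section Basics.
Variables (A : algType K) (rho : A -> V -> V).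
Hypothesis rho_rep : is_rep rho.

Lemma rep0l v : rho 0 v = 0.
Proof. by rewrite -(scale0r (0 : A)) repZl // scale0r. Qed.

Lemma rep0r x : rho x 0 = 0.
Proof. by rewrite -{1}(scale0r (0 : V)) repZr // scale0r. Qed.

Lemma repBl x y v : rho (x - y) v = rho x v - rho y v.
Proof. by rewrite repDl // -[- y]scaleN1r repZl // scaleN1r. Qed.

Lemma rep_suml n (F : 'I_n -> A) v : rho (\sum_i F i) v = \sum_i rho (F i) v.
Proof.
elim/big_ind2: _ => [|x x' y y' <- <-|//]; first exact: rep0l.
by rewrite repDl.
Qed.

Lemma rep_rel s t v : rho (t ^+ 2 * s - s * t ^+ 2 - t * s ^+ 2 + s ^+ 2 * t) v
  = rho t (rho t (rho s v)) - rho s (rho t (rho t v)) - rho t (rho s (rho s v))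
    + rho s (rho s (rho t v)).
Proof. by rewrite !expr2 repDl // !repBl !(repM rho_rep). Qed.

Lemma quot_rep (X : A -> Prop) : (forall x v, X x -> rho x v = 0) ->
  exists2 rho' : quot_alg X -> V -> V, is_rep rho'
    & forall x v, rho' (quot_pi X x) v = rho x v.
Proof.
move=> X0; have I0 x v : ideal_gen X x -> rho x v = 0.
  move=> Ix; elim: Ix v => {x} [|x Xx|x y _ IHx _ IHy|x y _ IHy|x y _ IHx] v.
  - exact: rep0l.
  - exact: X0.
  - by rewrite repDl // IHx IHy addr0.
  - by rewrite repM // IHy rep0r.
  - by rewrite repM // IHx.
have piE x v : rho (repr (quot_pi X x)) v = rho x v.
  apply/eqP; rewrite -subr_eq0 -repBl I0 //.
  by have /quot_idealP[] := quot_ideal_repr X x.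
exists (fun q => rho (repr q)) => //; split.
- by elim/quot_ind=> x; elim/quot_ind=> y v; rewrite -quot_piD !piE repDl.
- by move=> k; elim/quot_ind=> x v; rewrite -[_ *: _]quot_piZ !piE repZl.
- by move=> v; rewrite [1]/(quot_pi X 1) piE rep1.
- by elim/quot_ind=> x; elim/quot_ind=> y v; rewrite -[_ * _]quot_piM !piE repM.
- by move=> x v w; rewrite repDr.
- by move=> k x v; rewrite repZr.
Qed.

End Basics.

Lemma grpalg_rep (G : groupType) (act : G -> V -> V) :
    (forall v, act 1%g v = v) -> (forall g h v, act (g * h)%g v = act g (act h v)) ->
    (forall g v w, act g (v + w) = act g v + act g w) ->
    (forall k g v, act g (k *: v) = k *: act g v) ->
  exists2 rho : grpalg K G -> V -> V, is_rep rho
    & forall g v, rho (grpalg_in K g) v = act g v.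
Proof.
move=> act1 actM actD actZ.
pose rho (x : grpalg K G) v := \sum_(g <- msupp x) x@_g *: act g v.
have rhow (D : {fset G}) x v : (msupp x `<=` D)%fset ->
    rho x v = \sum_(g <- D) x@_g *: act g v.
  move=> leD; rewrite /rho (big_fset_incl _ leD) //= => g _.
  by move/mcoeff_outdom ->; rewrite scale0r.
have rhoU k g v : rho << k *g g >> v = k *: act g v.
  by rewrite (rhow _ _ _ msuppU_le) big_seq_fset1 mcoeffUU.
have rhoD x y v : rho (x + y) v = rho x v + rho y v.
  rewrite (rhow _ _ _ (msuppD_le x y)).
  rewrite (rhow _ x v (fsubsetUl (msupp x) (msupp y))).
  rewrite (rhow _ y v (fsubsetUr (msupp x) (msupp y))) -big_split /=.
  by apply/eq_bigr=> g _; rewrite mcoeffD scalerDl.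
have rho0 v : rho 0 v = 0 by rewrite /rho msupp0 big_seq_fset0.
have rhovD x v w : rho x (v + w) = rho x v + rho x w.
  by rewrite /rho -big_split; apply/eq_bigr=> g _; rewrite actD scalerDr.
have rhov0 x : rho x 0 = 0.
  by apply: (addrI (rho x 0)); rewrite -rhovD !addr0.
exists rho; last by move=> g v; rewrite rhoU scale1r.
split=> // [k x v|v|x y v|k x v].
- elim/grpalg_ind: x => [|x y Px Py|d g]; first by rewrite scaler0 rho0 scaler0.
    by rewrite scalerDr !rhoD scalerDr Px Py.
  by rewrite grpalg_scaleU !rhoU scalerA.
- by rewrite rhoU scale1r act1.
- elim/grpalg_ind: x => [|x z Px Pz|d g]; first by rewrite mul0r !rho0.
    by rewrite mulrDl !rhoD Px Pz.
  elim/grpalg_ind: y => [|x z Px Pz|l h]; first by rewrite mulr0 rho0 rhov0.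
    by rewrite mulrDr !rhoD rhovD Px Pz.
  by rewrite grpalgMU !rhoU actM actZ scalerA.
- rewrite /rho scaler_sumr; apply/eq_bigr=> g _.
  by rewrite actZ !scalerA mulrC.
Qed.

Section CalK.
Variables (a b c : K) (n : nat) (op iop : nat -> V -> V).
Hypothesis opD : forall i v w, op i (v + w) = op i v + op i w.
Hypothesis opZ : forall i k v, op i (k *: v) = k *: op i v.
Hypothesis opK : forall i, (0 < i < n)%N -> cancel (op i) (iop i).
Hypothesis iopK : forall i, (0 < i < n)%N -> cancel (iop i) (op i).
Hypothesis op_braid : forall i v, (0 < i)%N -> (i.+1 < n)%N ->
  op i (op i.+1 (op i v)) = op i.+1 (op i (op i.+1 v)).
Hypothesis op_comm : forall i j v, (0 < i)%N -> (i.+1 < j < n)%N ->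
  op i (op j v) = op j (op i v).
Hypothesis op_cubic : forall v, (1 < n)%N ->
  let d k v := op 1 v - k *: v in d a (d b (d c v)) = 0.
Hypothesis op_rel : forall v, (2 < n)%N ->
  op 2 (op 2 (op 1 v)) - op 1 (op 2 (op 2 v)) - op 2 (op 1 (op 1 v))
  + op 1 (op 1 (op 2 v)) = 0.

Let letter_act (l : artin_index n * bool) : V -> V :=
  if l.2 then op (val l.1) else iop (val l.1).

Let word_act (w : word (artin_index n)) (v : V) : V := foldr letter_act v w.

Let word_act_cat u w v : word_act (u ++ w) v = word_act u (word_act w v).
Proof. exact: foldr_cat. Qed.

Let word_act_eq u w v : pres_eq (@artin_rel n) u w -> word_act u v = word_act w v.
Proof.
move=> uw; elim: uw v => {u w} [_ _ [] [i im] [j jm] /= ij|i x|u u' w w' _ Eu _ Ew|//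
  |u w _ E|u w t _ E _ E'] v.
- have {}ij : j = i.+1 :> nat := ij; subst j.
  by have [/andP[i0 _] /andP[_ jn]] := (im, jm); apply: (op_braid v i0 jn).
- have {}ij : (i.+1 < j)%N := ij.
  have [/andP[i0 _] /andP[_ jn]] := (im, jm).
  by apply: (op_comm v i0); rewrite ij.
- by case: i => i im; case: x; rewrite /word_act /letter_act /= ?opK ?iopK.
- by rewrite !word_act_cat Ew Eu.
- by rewrite E.
- by rewrite E E'.
Qed.

(** Universal property of K_n, obtained along its presentation: words, braid group, group algebra,
    cubic quotient, then the last relation. The operators [iop] serve for the inverse letters. *)
Lemma calK_rep : exists2 rho : calK a b c n -> V -> V, is_rep rho
  & forall i v, (0 < i < n)%N -> rho (calK_gen a b c n i) v = op i v.
Proof.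
have iopD i v w : (0 < i < n)%N -> iop i (v + w) = iop i v + iop i w.
  by move=> im; rewrite -{1}(iopK im v) -{1}(iopK im w) -opD opK.
have iopZ i k v : (0 < i < n)%N -> iop i (k *: v) = k *: iop i v.
  by move=> im; rewrite -{1}(iopK im v) -opZ opK.
have wordD w v v' : word_act w (v + v') = word_act w v + word_act w v'.
  elim: w => // -[[i im] x] w /= ->; rewrite /letter_act.
  by case: x => /=; rewrite ?opD ?iopD.
have wordZ w k v : word_act w (k *: v) = k *: word_act w v.
  elim: w => // -[[i im] x] w /= ->; rewrite /letter_act.
  by case: x => /=; rewrite ?opZ ?iopZ.
pose act (g : braid_group n) := word_act (repr g).
have actE w v : act (pres_class _ w) v = word_act w v.
  exact/word_act_eq/pres_eq_repr.
have [||||rho rho_rep rhoE] := @grpalg_rep (braid_group n) act.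
- exact: actE.
- elim/pres_ind=> u; elim/pres_ind=> w v.
  by rewrite -[(_ * _)%g]pres_classM !actE word_act_cat.
- by move=> g; apply: wordD.
- by move=> k g; apply: wordZ.
have rho_gen i v : (0 < i < n)%N -> rho (grpalg_in K (artin n i)) v = op i v.
  by move=> im; rewrite rhoE /artin insubT actE.
have [|rho1 rho1_rep rho1E] := quot_rep rho_rep (X := @cubic_rel K a b c n).
  move=> _ v [n1 ->]; have subE k w : rho (grpalg_in K (artin n 1) - k *: 1) w = op 1 w - k *: w.
    by rewrite (repBl rho_rep) (repZl rho_rep) (rep1 rho_rep) rho_gen.
  rewrite (repM rho_rep) (repM rho_rep) (subE a) (subE b) (subE c).
  exact: op_cubic.
have rho1_gen i v : (0 < i < n)%N -> rho1 (cubicH_gen a b c n i) v = op i v.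
  by move=> im; rewrite rho1E rho_gen.
have [|rho2 rho2_rep rho2E] := quot_rep rho1_rep (X := @calK_rel K a b c n).
  move=> _ v [n2 ->]; have [n1 n2'] : (0 < 1 < n)%N /\ (0 < 2 < n)%N by lia.
  rewrite (rep_rel rho1_rep) !(rho1_gen 1%N) // !(rho1_gen 2) //.
  exact: op_rel.
exists rho2 => // i v im.
by rewrite rho2E rho1_gen.
Qed.

End CalK.

End Representations.

(** * Jimbo's R-matrices on functions of words *)

Definition swap (j : nat) (w : nat -> nat) : nat -> nat :=
  fun i => if i == j then w j.+1 else if i == j.+1 then w j else w i.

Lemma swapK j : involutive (swap j).
Proof.
move=> w; apply: funext => i; rewrite /swap.
by do !case: eqP => //; intros; try lia; congr w; lia.
Qed.

Section Jimbo.
Variables (K : fieldType) (x y : K).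

Local Notation V := ((nat -> nat) -> K^o).

(* Jimbo's R-matrix with eigenvalues x and y, transposed so as to act on all functions of words; two equal letters give
   the eigenvalue x, so that constant words carry the character s_j |-> x. *)
Definition jimbo (j : nat) (F : V) : V := fun w =>
  if (w j.+1 < w j)%N then F (swap j w)
  else if (w j < w j.+1)%N then (x + y) * F w - x * y * F (swap j w)
  else x * F w.

Lemma jimboD j F G : jimbo j (F + G) = jimbo j F + jimbo j G.
Proof.
apply: funext => w; rewrite !fctE /jimbo.
by case: ifP => _ //; case: ifP => _; ring.
Qed.

Lemma jimboZ j k F : jimbo j (k *: F) = k *: jimbo j F.
Proof.
apply: funext => w; rewrite !fctE /jimbo.
by case: ifP => _ //; case: ifP => _; rewrite /GRing.scale /=; ring.
Qed.

Lemma jimbo_quadratic j F : jimbo j (jimbo j F) = (x + y) *: jimbo j F - (x * y) *: F.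
Proof.
apply: funext => w; rewrite !fctE /jimbo swapK /GRing.scale /=.
have -> : swap j w j = w j.+1 by rewrite /swap eqxx.
have -> : swap j w j.+1 = w j by rewrite /swap eqxx ifN //; lia.
by case: (ltngtP (w j) (w j.+1)) => // _; ring.
Qed.

(** Isolates the three letters seen by the generators [j] and [j.+1]; [step] is then the action of
    [jimbo] on a function of two letters. *)
Definition upd3 (j : nat) (w : nat -> nat) (p q r : nat) : nat -> nat :=
  fun i => if i == j then p else if i == j.+1 then q else if i == j.+2 then r else w i.

Let step (Phi : nat -> nat -> K) (p q : nat) : K :=
  if (q < p)%N then Phi q p
  else if (p < q)%N then (x + y) * Phi p q - x * y * Phi q p else x * Phi p q.

Lemma upd3_id j w : upd3 j w (w j) (w j.+1) (w j.+2) = w.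
Proof. by apply: funext => i; rewrite /upd3; do !case: eqP => [->|_]. Qed.

Lemma jimbo_upd3l j w F p q r : jimbo j F (upd3 j w p q r) =
  step (fun p q => F (upd3 j w p q r)) p q.
Proof.
have swE : swap j (upd3 j w p q r) = upd3 j w q p r.
  by apply: funext => i; rewrite /swap /upd3; do !case: eqP => //; lia.
rewrite /jimbo swE; have -> : upd3 j w p q r j = p by rewrite /upd3 eqxx.
by have -> : upd3 j w p q r j.+1 = q by rewrite /upd3; do !case: eqP => //; lia.
Qed.

Lemma jimbo_upd3r j w F p q r : jimbo j.+1 F (upd3 j w p q r) =
  step (fun q r => F (upd3 j w p q r)) q r.
Proof.
have swE : swap j.+1 (upd3 j w p q r) = upd3 j w p r q.
  by apply: funext => i; rewrite /swap /upd3; do !case: eqP => //; lia.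
rewrite /jimbo swE.
have -> : upd3 j w p q r j.+1 = q by rewrite /upd3; do !case: eqP => //; lia.
by have -> : upd3 j w p q r j.+2 = r by rewrite /upd3; do !case: eqP => //; lia.
Qed.

(** With the rest of the word frozen, both sides depend only on a function of three letters, and
    every relative order of these letters gives a ring identity. *)
Lemma jimbo_braid j F :
  jimbo j (jimbo j.+1 (jimbo j F)) = jimbo j.+1 (jimbo j (jimbo j.+1 F)).
Proof.
apply: funext => w; rewrite -(upd3_id j w).
move: (w j) (w j.+1) (w j.+2) => p q r.
rewrite jimbo_upd3l jimbo_upd3r /step !(jimbo_upd3l, jimbo_upd3r) /step.
rewrite !(jimbo_upd3l, jimbo_upd3r) /step.
set Phi := fun p q r => F (upd3 j w p q r).
do 6!rewrite -/(Phi _ _ _).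
have [pq|pq|pq] := ltngtP p q; have [qr|qr|qr] := ltngtP q r;
  have [pr|pr|pr] := ltngtP p r; try lia; subst.
all: by ring.
Qed.

Lemma jimbo_comm i j F : (i.+1 < j)%N -> jimbo i (jimbo j F) = jimbo j (jimbo i F).
Proof.
move=> ij; apply: funext => w; rewrite /jimbo.
have swE : swap i (swap j w) = swap j (swap i w).
  by apply: funext => k; rewrite /swap; do !case: eqP => //; lia.
have [-> ->] : swap i w j = w j /\ swap i w j.+1 = w j.+1.
  by rewrite /swap; do !case: eqP => //; lia.
have [-> ->] : swap j w i = w i /\ swap j w i.+1 = w i.+1.
  by rewrite /swap; do !case: eqP => //; lia.
rewrite swE.
by case: (ltngtP (w i) (w i.+1)) => _; case: (ltngtP (w j) (w j.+1)) => _ //; ring.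
Qed.

End Jimbo.

Section JimboRep.
Variables (K : fieldType) (a b c : K) (n : nat).
Hypotheses (a_neq0 : a != 0) (b_neq0 : b != 0) (c_neq0 : c != 0).

Local Notation V := ((nat -> nat) -> K^o).
Local Notation ev := (ev a b c).

Lemma jimbo_calK_rep t u : t <> u ->
  exists2 rho : calK a b c n -> V -> V, is_rep rho
    & forall i F, (0 < i < n)%N -> rho (calK_gen a b c n i) F = jimbo (ev t) (ev u) i F.
Proof.
move=> tu; have xy0 : ev t * ev u != 0 by rewrite mulf_neq0 // ev_neq0.
(* The quadratic relation reads T (x + y - T) = x y, which gives the inverse of T. *)
have opK i : cancel (jimbo (ev t) (ev u) i)
    (fun F => (ev t * ev u)^-1 *: ((ev t + ev u) *: F - jimbo (ev t) (ev u) i F)).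
  move=> F; rewrite jimbo_quadratic opprB addrC subrK scalerA mulVf //.
  exact: scale1r.
have jimboB i F G : jimbo (ev t) (ev u) i (F - G) = jimbo (ev t) (ev u) i F - jimbo (ev t) (ev u) i G.
  by rewrite jimboD -scaleN1r jimboZ scaleN1r.
apply: (calK_rep (iop := fun i F => (ev t * ev u)^-1 *: ((ev t + ev u) *: F - jimbo (ev t) (ev u) i F))).
- exact: jimboD.
- exact: jimboZ.
- by move=> i _; apply: opK.
- by move=> i _ F; rewrite jimboZ jimboB jimboZ jimbo_quadratic opprB addrC subrK scalerA mulVf ?scale1r.
- by move=> i F _ _; apply: jimbo_braid.
- by move=> i j F _ /andP[ij _]; apply: jimbo_comm.
(* The combinations of [F] and its image are stable under T - z; [dE] computes in these coordinates,
   and the cubic relation becomes scalar identities. *)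
- move=> F _ d; pose v k l : V := k *: jimbo (ev t) (ev u) 1 F + l *: F.
  have dE z k l : d z (v k l) = v (k * (ev t + ev u) + l - z * k) (- (k * (ev t * ev u)) - z * l).
    rewrite /d /v jimboD !jimboZ jimbo_quadratic.
    apply: funext => w; rewrite !fctE /GRing.scale /=; ring.
  have -> : F = v 0 1 by rewrite /v scale0r scale1r add0r.
  rewrite !dE; apply: funext => w; rewrite /v !fctE /GRing.scale /=.
  rewrite -[RHS]/(0 : K).
  by clear v dE d xy0 opK jimboB; case: t u tu => -[] //= _; ring.
(* Once all squares are linearized by the quadratic relation, the relator cancels identically. *)
- move=> F _; rewrite !jimbo_quadratic !jimboB !jimboZ.
  by apply: funext => w; rewrite !fctE /GRing.scale /= -[RHS]/(0 : K); ring.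
Qed.

End JimboRep.

(** * Transport of the relations to all generators *)

Section Conjugation.
Variables (K : fieldType) (A : algType K) (a b c : K) (g h : A).
Hypothesis gh : g * h = 1.

Lemma conj_eq0 x y : x * g = g * y -> y = 0 -> x = 0.
Proof. by move=> xg y0; rewrite -[x]mulr1 -gh mulrA xg y0 mulr0 mul0r. Qed.

Lemma conj_mul x x' y y' : x * g = g * y -> x' * g = g * y' -> x * x' * g = g * (y * y').
Proof. by move=> xg xg'; rewrite -mulrA xg' mulrA xg mulrA. Qed.

Lemma conj_cubic x y : x * g = g * y -> cubic_root a b c y -> cubic_root a b c x.
Proof.
move=> xg; apply: conj_eq0; have sub k : (x - k *: 1) * g = g * (y - k *: 1).
  by rewrite mulrBl mulrBr xg mulr_algl mulr_algr.
by do !apply: conj_mul.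
Qed.

Lemma conj_rel x x' y y' : x * g = g * y -> x' * g = g * y' ->
    y' ^+ 2 * y - y * y' ^+ 2 - y' * y ^+ 2 + y ^+ 2 * y' = 0 ->
  x' ^+ 2 * x - x * x' ^+ 2 - x' * x ^+ 2 + x ^+ 2 * x' = 0.
Proof.
move=> xg xg'; apply: conj_eq0; rewrite !expr2 mulrDl !mulrBl mulrDr !mulrBr.
by congr (_ - _ - _ + _); do !apply: conj_mul.
Qed.

End Conjugation.

(** The constant term of the cubic is invertible, so an inverse of [x] is a polynomial in [x]. *)
Lemma cubic_inv (K : fieldType) (A : algType K) (a b c : K) (x t : A) :
    a * b * c != 0 -> cubic_root a b c x -> t * x = 1 ->
  t = (a * b * c)^-1 *: (x ^+ 2 - (a + b + c) *: x + (a * b + a * c + b * c) *: 1).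
Proof.
set e3 := a * b * c => e30 x0 tx.
set q := _ - _ + _; suff xq : x * q = e3 *: 1.
  by rewrite -[q]mul1r -tx -mulrA xq -scalerAr mulr1 scalerA mulVf ?scale1r.
rewrite mulrDr mulrBr -!scalerAr mulr1 -exprS (cubicE x0) -expr2.
by rewrite addrAC [_ - _ + _]addrAC subrK addrC addKr.
Qed.

(** Conjugation by two consecutive generators carries the first to the second, and conjugation by
    three carries the first adjacent pair to the next one. The relations at indices 1 and 2 thus
    spread to all indices. *)
Lemma conj_cubic_system (K : fieldType) (A : algType K) (a b c : K) (s : nat -> A) (n : nat) :
    (forall i, (0 < i < n)%N -> exists t, s i * t = 1) ->
    (forall i, (0 < i)%N -> (i.+1 < n)%N -> s i * s i.+1 * s i = s i.+1 * s i * s i.+1) ->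
    (forall i j, (0 < i)%N -> (i.+1 < j < n)%N -> s i * s j = s j * s i) ->
    ((1 < n)%N -> cubic_root a b c (s 1)) ->
    ((2 < n)%N -> s 2 ^+ 2 * s 1 - s 1 * s 2 ^+ 2 - s 2 * s 1 ^+ 2 + s 1 ^+ 2 * s 2 = 0) ->
  cubic_system a b c s n.
Proof.
move=> s_unit s_braid s_comm s_cubic s_rel; split=> //.
  case=> // i; elim: i => [|i IHi] im; first by apply: s_cubic; lia.
  have [t1 st1] := s_unit i.+1 (ltac:(lia)); have [t2 st2] := s_unit i.+2 (ltac:(lia)).
  have gh : s i.+1 * s i.+2 * (t2 * t1) = 1 by rewrite -mulrA (mulrA (s i.+2)) st2 mul1r.
  apply: (conj_cubic gh (y := s i.+1)); last by apply: IHi; lia.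
  by rewrite mulrA -s_braid //; lia.
case=> // i _; elim: i => [|i IHi] im; first exact: s_rel.
have [t1 st1] := s_unit i.+1 (ltac:(lia)); have [t2 st2] := s_unit i.+2 (ltac:(lia)).
have [t3 st3] := s_unit i.+3 (ltac:(lia)).
have gh : s i.+1 * s i.+2 * s i.+3 * (t3 * (t2 * t1)) = 1.
  by rewrite -!mulrA (mulrA (s i.+3)) st3 mul1r (mulrA (s i.+2)) st2 mul1r.
apply: (conj_rel gh (y := s i.+1) (y' := s i.+2)); last by apply: IHi; lia.
  rewrite !mulrA -s_braid; try lia.
  by rewrite -!mulrA (s_comm i.+1) //; lia.
rewrite -!mulrA (mulrA (s i.+2)) (s_braid i.+2); try lia.
by rewrite !mulrA (s_comm i.+1) //; lia.
Qed.

Section QuotientMorphism.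
Variables (K : fieldType) (A : algType K) (X : A -> Prop).
Implicit Types x y : A.

Lemma quot_pi_mul x y : quot_pi X (x * y) = quot_pi X x * quot_pi X y.
Proof. exact: quot_piM. Qed.

Lemma quot_pi_scale k x : quot_pi X (k *: x) = k *: quot_pi X x.
Proof. exact: quot_piZ. Qed.

Lemma quot_pi_one : quot_pi X 1 = 1.
Proof. by []. Qed.

Lemma quot_piB x y : quot_pi X (x - y) = quot_pi X x - quot_pi X y.
Proof. by apply/(addIr (quot_pi X y)); rewrite -quot_piD !subrK. Qed.

Lemma quot_pi_rel x : ~ ideal_gen X 1 -> X x -> quot_pi X x = 0.
Proof.
by move=> X1 Xx; rewrite -(quot_pi0 X); apply/(quot_piP X1); rewrite subr0; apply: ideal_genX.
Qed.

Lemma quot_pi_cubic a b c x :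
  quot_pi X ((x - a *: 1) * (x - b *: 1) * (x - c *: 1)) = 0 -> cubic_root a b c (quot_pi X x).
Proof. by rewrite !quot_pi_mul !quot_piB !quot_pi_scale !quot_pi_one. Qed.

Lemma quot_pi_relator x y :
  quot_pi X (y ^+ 2 * x - x * y ^+ 2 - y * x ^+ 2 + x ^+ 2 * y) = 0 ->
  let px := quot_pi X x in let py := quot_pi X y in
  py ^+ 2 * px - px * py ^+ 2 - py * px ^+ 2 + px ^+ 2 * py = 0.
Proof. by rewrite !expr2 quot_piD !quot_piB !quot_pi_mul. Qed.

End QuotientMorphism.

Section CalKSystem.
Variables (K : fieldType) (a b c : K) (n : nat).
Hypotheses (a_neq0 : a != 0) (b_neq0 : b != 0) (c_neq0 : c != 0).

Local Notation A := (calK a b c n).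
Local Notation s := (calK_gen a b c n).

Definition braid_image (g : braid_group n) : A :=
  quot_pi (@calK_rel K a b c n) (quot_pi (@cubic_rel K a b c n) (grpalg_in K g)).

Lemma braid_imageM g h : braid_image (g * h)%g = braid_image g * braid_image h.
Proof. by rewrite /braid_image -!quot_pi_mul grpalgMU mulr1. Qed.

Lemma braid_image1 : braid_image 1%g = 1.
Proof. by rewrite -quot_pi_one -quot_pi_one. Qed.

Lemma artinE i (im : (0 < i < n)%N) :
  artin n i = pres_class (@artin_rel n) [:: (exist _ i im : artin_index n, true)].
Proof. by rewrite /artin insubT. Qed.

Lemma pres_class_mul u v :
  (pres_class (@artin_rel n) u * pres_class (@artin_rel n) v)%g = pres_class (@artin_rel n) (u ++ v).
Proof. by rewrite pres_classM. Qed.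

Lemma artin_braidE i : (0 < i)%N -> (i.+1 < n)%N ->
  (artin n i * artin n i.+1 * artin n i = artin n i.+1 * artin n i * artin n i.+1)%g.
Proof.
move=> i0 im; have [im1 im2] : (0 < i < n)%N /\ (0 < i.+1 < n)%N by lia.
rewrite (artinE im1) (artinE im2) 2!(pres_class_mul [:: _] [:: _]).
rewrite 2!(pres_class_mul [:: _; _] [:: _]); apply/pres_classP/pres_eq_rel.
exact: (@artin_braid n (exist _ i im1) (exist _ i.+1 im2) erefl).
Qed.

Lemma artin_commE i j : (0 < i)%N -> (i.+1 < j < n)%N ->
  (artin n i * artin n j = artin n j * artin n i)%g.
Proof.
move=> i0 /andP[ij jn]; have [im1 im2] : (0 < i < n)%N /\ (0 < j < n)%N by lia.
rewrite (artinE im1) (artinE im2) 2!(pres_class_mul [:: _] [:: _]).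
apply/pres_classP/pres_eq_rel.
exact: (@artin_comm n (exist _ i im1) (exist _ j im2) ij).
Qed.

Lemma calK_braid i : (0 < i)%N -> (i.+1 < n)%N -> s i * s i.+1 * s i = s i.+1 * s i * s i.+1.
Proof.
by move=> i0 im; rewrite -[LHS]/(braid_image _ * braid_image _ * braid_image _)
  -[RHS]/(braid_image _ * braid_image _ * braid_image _) -!braid_imageM artin_braidE.
Qed.

Lemma calK_comm i j : (0 < i)%N -> (i.+1 < j < n)%N -> s i * s j = s j * s i.
Proof.
by move=> i0 im; rewrite -[LHS]/(braid_image _ * braid_image _)
  -[RHS]/(braid_image _ * braid_image _) -!braid_imageM artin_commE.
Qed.

Lemma calK_cubic1 : (1 < n)%N -> cubic_root a b c (s 1).
Proof.
move=> n1; apply: quot_pi_cubic; rewrite [X in quot_pi _ X](_ : _ = 0) ?quot_pi0 //.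
apply: quot_pi_cubic; apply: quot_pi_rel (conj n1 erefl).
exact: (cubic_rel_proper (b := b) (c := c) (n := n) a_neq0).
Qed.

Lemma calK_rel1 : (2 < n)%N ->
  s 2 ^+ 2 * s 1 - s 1 * s 2 ^+ 2 - s 2 * s 1 ^+ 2 + s 1 ^+ 2 * s 2 = 0.
Proof.
move=> n2; apply: quot_pi_relator; apply: quot_pi_rel (conj n2 erefl).
exact: (calK_rel_proper (b := b) (c := c) (n := n) a_neq0).
Qed.

Lemma calK_system : cubic_system a b c s n.
Proof.
apply: conj_cubic_system.
- move=> i im; exists (braid_image (artin n i)^-1%g).
  by rewrite -[s i]/(braid_image _) -braid_imageM mulgV braid_image1.
- exact: calK_braid.
- exact: calK_comm.
- exact: calK_cubic1.
- exact: calK_rel1.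
Qed.

(** The inverse letters of a braid word are polynomials in the generators by [cubic_inv]. *)
Lemma gen_subalg_full x : gen_subalg s n x.
Proof.
elim/quot_ind: x => x; elim/quot_ind: x => x.
elim/grpalg_ind: x => [|x y Bx By|k g].
- by rewrite !quot_pi0; apply: subalg_gen0.
- by rewrite !quot_piD; apply: subalg_genD.
rewrite -[k]mulr1 -grpalg_scaleU !quot_piZ -[quot_scale _ _]/(k *: braid_image g).
apply: subalg_genZ; elim/pres_ind: g => w.
elim: w => [|[i x] w IHw].
  by rewrite [braid_image _]braid_image1; apply: subalg_gen1.
rewrite -cat1s -pres_class_mul braid_imageM; apply: subalg_genM IHw.
case: i => i im.
have sE : braid_image (pres_class _ [:: (exist _ i im : artin_index n, true)]) = s i.
  by rewrite -artinE.
case: x; first by rewrite sE; apply: gen_subalg_gen.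
have [cubic _ _ _] := calK_system.
set t := braid_image _.
have ts : t * s i = 1.
  rewrite -sE -braid_imageM -braid_image1 (pres_class_mul [:: _] [:: _]).
  by congr braid_image; apply/pres_classP; apply: (pres_eq_cancel _ _ false).
rewrite (cubic_inv (x := s i) _ (cubic i im) ts) ?mulf_neq0 //.
have Bs : gen_subalg s n (s i) by apply: gen_subalg_gen.
apply: subalg_genZ; apply: subalg_genD; last exact/subalg_genZ/subalg_gen1.
by apply: subalg_genB; [exact: subalg_genX2 | exact: subalg_genZ].
Qed.

End CalKSystem.

(** * Direct sums and dimensions *)

Section DirectSum.
Variables (K : fieldType) (A : algType K).

Lemma is_direct_sumP (Ws : seq (A -> Prop)) :
    let W := nth (fun=> False) Ws in
    (forall v, exists2 U : nat -> A, forall i, (i < size Ws)%N -> W i (U i)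
       & v = \sum_(i < size Ws) U i) ->
    (forall U U' : nat -> A,
      (forall i, (i < size Ws)%N -> W i (U i)) -> (forall i, (i < size Ws)%N -> W i (U' i)) ->
      \sum_(i < size Ws) U i = \sum_(i < size Ws) U' i ->
      forall i, (i < size Ws)%N -> U i = U' i) ->
  is_direct_sum Ws.
Proof.
move=> W exU uniU v; have [U UW vU] := exU v.
exists [ffun i : 'I_(size Ws) => U i]; split=> [|u' [u'W vu']].
  split=> [i|]; first by rewrite ffunE (tnth_nth (fun=> False)); apply: UW.
  by rewrite vU; apply: eq_bigr => i _; rewrite ffunE.
(* The family on ordinals is extended by 0 to all of [nat]. *)
pose U' k := oapp u' 0 (insub k).
have U'E (i : 'I_(size Ws)) : U' i = u' i by rewrite /U' valK.
apply/ffunP => i; rewrite ffunE -U'E; apply: uniU => // [k kW|].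
  by have := u'W (Ordinal kW); rewrite (tnth_nth (fun=> False)) -U'E.
by rewrite -vU vu'; apply: eq_bigr => k _; rewrite U'E.
Qed.

Definition basis_of_sub (W : A -> Prop) (I : finType) (e : I -> A) : Prop :=
  [/\ forall i, W (e i), forall x, W x -> exists z : I -> K, x = \sum_i z i *: e i
    & forall z : I -> K, \sum_i z i *: e i = 0 -> forall i, z i = 0].

Lemma has_dim_basis (I : finType) (e : I -> A) :
  basis_of_sub (fun=> True) e -> has_dim A #|I|.
Proof.
move=> [_ e_span e_free].
pose r2v (r : 'rV[K]_#|I|) : A := \sum_i r 0 (enum_rank i) *: e i.
have r2vD k r r' : r2v (k *: r + r') = k *: r2v r + r2v r'.
  rewrite /r2v scaler_sumr -big_split; apply: eq_bigr => i _.
  by rewrite !mxE scalerDl scalerA.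
have r2v_inj : injective r2v.
  move=> r r' rr'; apply/rowP => j; apply/eqP; rewrite -subr_eq0; apply/eqP.
  rewrite -(enum_valK j).
  apply: (e_free (fun i => r 0 (enum_rank i) - r' 0 (enum_rank i))).
  transitivity (r2v r - r2v r'); last by rewrite rr' subrr.
  by rewrite /r2v -sumrB; apply: eq_bigr => i _; rewrite scalerBl.
have [v2r v2rK] : {v2r : A -> 'rV[K]_#|I| & cancel v2r r2v}.
  apply: (boolp.choice (P := fun x r => r2v r = x)) => x; have [z ->] := e_span x Logic.I.
  exists (\row_j z (enum_val j)); apply: eq_bigr => i _.
  by rewrite mxE enum_rankK.
have r2vK : cancel r2v v2r by move=> r; apply: r2v_inj; rewrite v2rK.
constructor; exists v2r; last by exists r2v.
by move=> k x y; apply: r2v_inj; rewrite r2vD !v2rK.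
Qed.

End DirectSum.

(** * Independence *)

Section Independence.
Variables (K : fieldType) (A : algType K) (a b c : K).
Hypotheses (a_neq0 : a != 0) (b_neq0 : b != 0) (c_neq0 : c != 0).
Hypothesis abc_distinct : (a - b) * (a - c) * (b - c) != 0.
Variables (s : nat -> A) (m : nat).
Hypothesis s_system : cubic_system a b c s m.

Local Notation V := ((nat -> nat) -> K^o).
Local Notation ev := (ev a b c).
Local Notation P i := (proj a b c (s i)).
Local Notation B := (gen_subalg s).

Variable rho : color -> color -> A -> V -> V.
Hypothesis rho_rep : forall t u, t <> u -> is_rep (rho t u).
Hypothesis rho_gen : forall t u i F, t <> u -> (0 < i < m)%N ->
  rho t u (s i) F = jimbo (ev t) (ev u) i F.

(** Both orders of a pair occur: the pair determines the Hecke algebra, and its first member the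
    character carried by constant words. *)
Definition vanishing (x : A) : Prop := forall t u F w, t <> u -> rho t u x F w = 0.

Lemma gen_subalg_le n n' x : (n <= n')%N -> B n x -> B n' x.
Proof.
move=> nn'; apply: subalg_gen_sub => _ [i im ->].
by apply: gen_subalg_gen; lia.
Qed.

(* On constant words every generator acts in the (t, u) representation by the scalar [ev t],
   whatever u is. *)
Lemma rho_char x : B m x -> exists chi : color -> K, forall t u F, t <> u ->
  rho t u x F (fun=> 0%N) = chi t * F (fun=> 0%N).
Proof.
elim=> {x} [|_ [i im ->]|x y _ [f fE] _ [g gE]|k x _ [f fE]|x y _ [f fE] _ [g gE]].
- by exists (fun=> 1) => t u F tu; rewrite (rep1 (rho_rep tu)) mul1r.
- by exists ev => t u F tu; rewrite rho_gen // /jimbo ltnn.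
- by exists (fun t => f t + g t) => t u F tu; rewrite (repDl (rho_rep tu)) mulrDl -(fE _ u) // -(gE _ u).
- by exists (fun t => k * f t) => t u F tu; rewrite (repZl (rho_rep tu)) -mulrA -(fE _ u).
- by exists (fun t => f t * g t) => t u F tu; rewrite (repM (rho_rep tu)) (fE _ u) // (gE _ u) // mulrA.
Qed.

Lemma gen_subalg2_proj x : (1 < m)%N -> B 2 x ->
  exists z : color -> K, x = z Red *: P 1 Red + z Green *: P 1 Green + z Blue *: P 1 Blue.
Proof.
move=> m1; have s1 : cubic_root a b c (s 1) by case: s_system => + _ _ _; apply; lia.
have [p1 pp p0] := proj_resolution abc_distinct s1.
have orth (z z' : color -> K) :
  (z Red *: P 1 Red + z Green *: P 1 Green + z Blue *: P 1 Blue)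
    * (z' Red *: P 1 Red + z' Green *: P 1 Green + z' Blue *: P 1 Blue)
  = (z Red * z' Red) *: P 1 Red + (z Green * z' Green) *: P 1 Green
    + (z Blue * z' Blue) *: P 1 Blue.
  have PP t u : (z t *: P 1 t) * (z' u *: P 1 u) = (z t * z' u) *: (P 1 t * P 1 u).
    by rewrite -scalerAl -scalerAr scalerA.
  rewrite !(mulrDl, mulrDr) !PP !pp.
  by do 6?[rewrite p0 //]; rewrite !scaler0 !(addr0, add0r).
elim=> {x} [|_ [i im ->]|x y _ [f ->] _ [g ->]|k x _ [f ->]|x y _ [f ->] _ [g ->]].
- by exists (fun=> 1); rewrite !scale1r p1.
- exists ev; have -> : i = 1%N by lia.
  by rewrite -!(mul_proj _ s1) -!mulrDr p1 mulr1.
- by exists (fun t => f t + g t); rewrite !scalerDl addrACA [X in X + _]addrACA.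
- by exists (fun t => k * f t); rewrite !scalerDr !scalerA.
- by exists (fun t => f t * g t); rewrite orth.
Qed.

(** Evaluating at a constant word reads off one coordinate: there [s 1] acts by [ev t], so [P 1 v]
    contributes 0 unless [v = t]. *)
Lemma rho_projs (z : color -> K) t u : (1 < m)%N -> t <> u ->
  rho t u (z Red *: P 1 Red + z Green *: P 1 Green + z Blue *: P 1 Blue)
    (fun=> 1) (fun=> 0%N) = z t.
Proof.
move=> m1 tu.
have s1 : cubic_root a b c (s 1) by case: s_system => + _ _ _; apply; lia.
have [p1 _ _] := proj_resolution abc_distinct s1.
pose e v := rho t u (P 1 v) (fun=> 1) (fun=> 0%N).
have e0 v : t <> v -> e v = 0.
  move=> tv; have := congr1 (fun x => rho t u x (fun=> 1) (fun=> 0%N)) (mul_proj v s1).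
  rewrite (repM (rho_rep tu)) (repZl (rho_rep tu) (ev v)) rho_gen //.
  rewrite /jimbo ltnn -[X in X = _ -> _]/(ev t * e v) -[X in _ = X -> _]/(ev v * e v) => /eqP.
  rewrite -subr_eq0 -mulrBl mulf_eq0 subr_eq0 (negPf (ev_inj _ tv)) //.
  by move/eqP.
have e1 : e Red + e Green + e Blue = 1.
  have := congr1 (fun x => rho t u x (fun=> 1) (fun=> 0%N)) p1.
  by rewrite (rep1 (rho_rep tu)) 2!(repDl (rho_rep tu)).
rewrite 2!(repDl (rho_rep tu)) (repZl (rho_rep tu) (z Red)).
rewrite (repZl (rho_rep tu) (z Green)) (repZl (rho_rep tu) (z Blue)).
rewrite -[LHS]/(z Red * e Red + z Green * e Green + z Blue * e Blue) -[RHS]mulr1 -e1.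
move: e0; clearbody e; case: t {tu e1} => e0.
- by rewrite [e Green]e0 // [e Blue]e0 // !(mulr0, addr0).
- by rewrite [e Red]e0 // [e Blue]e0 // !(mulr0, addr0, add0r).
- by rewrite [e Red]e0 // [e Green]e0 // !(mulr0, add0r).
Qed.

Lemma gen_subalg2_char0 x : (1 < m)%N -> B 2 x ->
  (forall t, exists2 u, t <> u & rho t u x (fun=> 1) (fun=> 0%N) = 0) -> x = 0.
Proof.
move=> m1 /(gen_subalg2_proj m1)[z ->] x0.
have z0 t : z t = 0 by have [u tu] := x0 t; rewrite rho_projs.
by rewrite !z0 !scale0r !addr0.
Qed.

Lemma projs_free (z : color -> K) t : (1 < m)%N ->
  z Red *: P 1 Red + z Green *: P 1 Green + z Blue *: P 1 Blue = 0 -> z t = 0.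
Proof.
move=> m1 z0; have [u tu] : exists u, t <> u by case: t; [exists Green|exists Red|exists Red].
by rewrite -(rho_projs z m1 tu) z0 (rep0l (rho_rep tu)).
Qed.

(** Below level [n] the action sees only swaps and comparisons of neighbouring letters, hence
    commutes with every change of words [theta] that respects them. *)
Lemma rho_local n x (theta : (nat -> nat) -> nat -> nat) t u F w :
    (n <= m)%N ->
    (forall j v, (0 < j < n)%N -> [/\ theta (swap j v) = swap j (theta v),
        (theta v j.+1 < theta v j)%N = (v j.+1 < v j)%N
      & (theta v j < theta v j.+1)%N = (v j < v j.+1)%N]) ->
    t <> u -> B n x ->
  rho t u x F (theta w) = rho t u x (F \o theta) w.
Proof.
move=> nm theta_eq tu Bx.
suff: rho t u x F \o theta = rho t u x (F \o theta) by move/(congr1 (@^~ w)).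
have rr := rho_rep tu.
elim: Bx F => {x} [|_ [i im ->]|x y _ IHx _ IHy|k x _ IHx|x y _ IHx _ IHy] F.
- by rewrite !(rep1 rr).
- rewrite !rho_gen //; try lia.
  apply: funext => v; rewrite /jimbo /=.
  by have [-> -> ->] := theta_eq i v im.
- by rewrite !(repDl rr) -IHx -IHy.
- by rewrite !(repZl rr) -IHx.
- by rewrite !(repM rr) IHx IHy.
Qed.

(** The letter at position n + 1 moves to position n + 1 - k, and those in between go one place to
    the right. *)
Definition insert_at (n k : nat) (w : nat -> nat) : nat -> nat := fun i =>
  if (i < n.+1 - k)%N then w i else if i == (n.+1 - k)%N then w n.+1
  else if (i <= n.+1)%N then w i.-1 else w i.

(** A strictly minimal last letter keeps every step in the first branch of [jimbo], a plain swap
    without coefficients. *)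
Lemma rho_desc n k t u F w : (n < m)%N -> (k <= n)%N -> t <> u ->
    (forall i, (0 < i <= n)%N -> (w n.+1 < w i)%N) ->
  rho t u (desc s n k) F w = F (insert_at n k w).
Proof.
move=> nm + tu w_min; elim: k F => [|k IHk] F kn.
  rewrite desc0 (rep1 (rho_rep tu)); congr F; apply: funext => i.
  by rewrite /insert_at; do ?case: ifP; move=> *; try lia; congr w; lia.
rewrite descS (repM (rho_rep tu)) IHk ?(ltnW kn) // rho_gen //; last by lia.
have wk : insert_at n k w (n - k).+1 = w n.+1.
  by rewrite /insert_at ifN ?ifT //; lia.
have wk' : insert_at n k w (n - k) = w (n - k)%N by rewrite /insert_at ifT //; lia.
rewrite /jimbo wk wk' w_min; last by lia.
congr F; apply: funext => i; rewrite /swap wk wk' /insert_at.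
have [->|ik] := eqVneq i (n - k)%N; first by do ?case: ifP; move=> *; try lia; congr w; lia.
have [->|ik'] := eqVneq i (n - k).+1.
  by do ?case: ifP; move=> *; try lia; congr w; lia.
by do ?case: ifP; move=> *; try lia; congr w; lia.
Qed.

Lemma rho_sum_descs n (f g : nat -> A) t u F w : (n < m)%N -> t <> u ->
  rho t u (\sum_(k < n.+1) f k * desc s n k + \sum_(k < n) g k * desc2 s n k) F w =
  \sum_(k < n.+1) rho t u (f k) (rho t u (desc s n k) F) w
  + \sum_(k < n) ((ev t + ev u) * rho t u (g k) (rho t u (desc s n k.+1) F) w
                  - ev t * ev u * rho t u (g k) (rho t u (desc s n k) F) w).
Proof.
move=> nm tu; have rr := rho_rep tu.
have sumE l (G : 'I_l -> V) : (\sum_i G i) w = \sum_i G i w by rewrite fct_sumE.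
rewrite (repDl rr) !(rep_suml rr) fctE !sumE; congr (_ + _); apply: eq_bigr => k _.
  by rewrite (repM rr).
have d2 : rho t u (desc2 s n k) F = (ev t + ev u) *: rho t u (desc s n k.+1) F
    - (ev t * ev u) *: rho t u (desc s n k) F.
  rewrite descS /desc2 expr2 !(repM rr) !rho_gen ?jimbo_quadratic //; try (have := ltn_ord k; lia).
  by rewrite -scaleN1r (repDr rr) !(repZr rr) scaleN1r.
by rewrite (repM rr) d2 -scaleN1r (repDr rr) !(repZr rr) scaleN1r.
Qed.

(* Multiplication by [desc s n k] moves the letter at position n + 1, made the smallest one by [theta], to position
   n + 1 - k; the test function [G] is supported on the words where it sits at position n + 1 - k0. *)
Lemma vanishing_coef n (f g : nat -> A) t u k0 F w : (n < m)%N -> (k0 <= n)%N -> t <> u ->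
    (forall k, B n (f k)) -> (forall k, B n (g k)) ->
    vanishing (\sum_(k < n.+1) f k * desc s n k + \sum_(k < n) g k * desc2 s n k) ->
  rho t u (f k0) F w
  + (if k0 is k.+1 then (ev t + ev u) * rho t u (g k) F w else 0)
  - (if (k0 < n)%N then ev t * ev u * rho t u (g k0) F w else 0) = 0.
Proof.
move=> nm kn tu Bf Bg x0; have rr := rho_rep tu.
(* [theta] raises the other letters to make room for 0; [del] removes that 0 from position n + 1 -
   k0, closes the gap and lowers the letters again. The net effect of [theta], the insertion and
   [del] is [theta'], which fixes [w]. *)
pose theta (v : nat -> nat) i := if i == n.+1 then 0%N else (v i).+1.
pose theta' (v : nat -> nat) i := if i == n.+1 then w n.+1 else v i.
pose del (v : nat -> nat) i := if i == n.+1 then w n.+1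
  else (if (i < n.+1 - k0)%N then v i else if (i <= n)%N then v i.+1 else v i).-1.
pose G : V := fun v => if v (n.+1 - k0)%N == 0%N then F (del v) else 0.
have DG k : (k <= n)%N ->
    rho t u (desc s n k) G \o theta = if k == k0 then F \o theta' else 0.
  move=> kn'; apply: funext => v; rewrite /= rho_desc //; last first.
    by move=> i im; rewrite /theta eqxx ifN //; lia.
  rewrite /G; have [->|kk0] := eqVneq k k0.
    rewrite {1}/insert_at ltnn eqxx /theta eqxx /=; congr F; apply: funext => i.
    rewrite /del /theta' /theta /insert_at.
    by do ?case: ifP; move=> * //=; try lia; congr v; lia.
  rewrite ifN // /insert_at /theta.
  by do ?case: ifP; move=> * //=; lia.
have thetaE j v : (0 < j < n)%N -> [/\ theta (swap j v) = swap j (theta v),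
        (theta v j.+1 < theta v j)%N = (v j.+1 < v j)%N
      & (theta v j < theta v j.+1)%N = (v j < v j.+1)%N].
  move=> jn; have [j1 j2] : (j == n.+1) = false /\ (j.+1 == n.+1) = false by lia.
  rewrite /theta j1 j2; split=> //; apply: funext => i; rewrite /swap j1 j2.
  by have [->|_] := eqVneq i j; [rewrite j1 | have [->|_] := eqVneq i j.+1; rewrite ?j2].
have thetaE' j v : (0 < j < n)%N -> [/\ theta' (swap j v) = swap j (theta' v),
        (theta' v j.+1 < theta' v j)%N = (v j.+1 < v j)%N
      & (theta' v j < theta' v j.+1)%N = (v j < v j.+1)%N].
  move=> jn; have [j1 j2] : (j == n.+1) = false /\ (j.+1 == n.+1) = false by lia.
  rewrite /theta' j1 j2; split=> //; apply: funext => i; rewrite /swap j1 j2.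
  by have [->|_] := eqVneq i j; [rewrite j1 | have [->|_] := eqVneq i j.+1; rewrite ?j2].
have theta'w : theta' w = w by apply: funext => i; rewrite /theta'; case: eqP => // ->.
have term x k : B n x -> (k <= n)%N ->
    rho t u x (rho t u (desc s n k) G) (theta w) = if k == k0 then rho t u x F w else 0.
  move=> Bx kn'; rewrite (rho_local (n := n)) ?(ltnW nm) // DG //.
  case: eqP => _; last by rewrite (rep0r rr).
  by rewrite -(rho_local (n := n)) ?(ltnW nm) // theta'w.
have := x0 t u G (theta w) tu; rewrite rho_sum_descs // => x0G.
rewrite -[RHS]x0G sumrB {x0G} addrA; congr (_ + _ - _).
- rewrite (bigD1 (Ordinal (kn : (k0 < n.+1)%N))) //= term // eqxx.
  rewrite big1 ?addr0 // => k.
  by rewrite -val_eqE /= => /negPf kk0; rewrite term ?kk0 // -ltnS.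
- transitivity (\sum_(k < n) (ev t + ev u) * (if k.+1 == k0 then rho t u (g k) F w else 0)).
    case: k0 kn {G del DG term} => [|k0] kn; first by rewrite big1 // => k _; rewrite mulr0.
    rewrite (bigD1 (Ordinal kn)) //= eqxx big1 ?addr0 // => k.
    by rewrite -val_eqE eqSS /= => /negPf->; rewrite mulr0.
  by apply: eq_bigr => k _; rewrite term.
- transitivity (\sum_(k < n) ev t * ev u * (if k == k0 :> nat then rho t u (g k) F w else 0)).
    case: ifP => k0n; last first.
      rewrite big1 // => k _; rewrite ifN ?mulr0 //; apply/eqP => kE.
      by move: k0n; rewrite -kE ltn_ord.
    rewrite (bigD1 (Ordinal k0n)) //= eqxx big1 ?addr0 // => k.
    by rewrite -val_eqE /= => /negPf->; rewrite mulr0.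
  by apply: eq_bigr => k _; rewrite term // ltnW.
Qed.

Lemma vanishing_descs n (f g : nat -> A) : (1 < n)%N -> (n < m)%N ->
    (forall x, B n x -> vanishing x -> x = 0) ->
    (forall k, B n (f k)) -> (forall k, B 2 (g k)) ->
    vanishing (\sum_(k < n.+1) f k * desc s n k + \sum_(k < n) g k * desc2 s n k) ->
  (forall k, (k <= n)%N -> f k = 0) /\ (forall k, (k < n)%N -> g k = 0).
Proof.
move=> n1 nm faithful Bf Bg x0.
have Bgn k : B n (g k) by apply: gen_subalg_le (Bg k).
have coef k0 t u F w (kn : (k0 <= n)%N) (tu : t <> u) :=
  @vanishing_coef n f g t u k0 F w nm kn tu Bf Bgn x0.
have g_char0 k : (forall t u F w, t <> u ->
    rho t u (f k.+1) F w + (ev t + ev u) * rho t u (g k) F w = 0) -> g k = 0.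
  move=> E; have [chif chifE] := rho_char (gen_subalg_le (ltnW nm) (Bf k.+1)).
  have [chig chigE] := rho_char (gen_subalg_le (ltnW nm) (Bgn k)).
  have Ec t u : t <> u -> chif t + (ev t + ev u) * chig t = 0.
    by move=> tu; have := E t u (fun=> 1) (fun=> 0%N) tu; rewrite chifE // chigE // !mulr1.
  apply: (gen_subalg2_char0 (ltn_trans n1 nm) (Bg k)) => t.
  (* For fixed [t], the equations for the partners [u] and [v] share [chif t]; their difference
     isolates [chig t]. *)
  have [u [v [tu tv uv]]] : exists u v, [/\ t <> u, t <> v & u <> v].
    by case: t; [exists Green, Blue | exists Red, Blue | exists Red, Green].
  exists u; rewrite // chigE // mulr1; apply/eqP.
  have : (ev u - ev v) * chig t = 0.
    rewrite -[RHS](subrr 0) -{1}(Ec t u tu) -(Ec t v tv); ring.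
  by move/eqP; rewrite mulf_eq0 subr_eq0 (negPf (ev_inj abc_distinct uv)).
(* Descending induction on [k]: at the top, [k = n - 1], there is no [g k.+1], and below it that
   term is already known to vanish. *)
have g0 d k : (n = k + d.+1)%N -> g k = 0.
  elim: d k => [|d IHd] k nE.
    have E t u F w : t <> u -> rho t u (f k.+1) F w + (ev t + ev u) * rho t u (g k) F w = 0.
      move=> tu; have := coef k.+1 t u F w (ltac:(lia)) tu.
      by rewrite ifN ?subr0 // -leqNgt nE addn1.
    exact: g_char0 E.
  have E t u F w : t <> u -> rho t u (f k.+1) F w + (ev t + ev u) * rho t u (g k) F w = 0.
    move=> tu; have := coef k.+1 t u F w (ltac:(lia)) tu.
    rewrite (IHd k.+1); last by lia.
    by rewrite (rep0l (rho_rep tu)) mulr0 if_same subr0.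
  exact: g_char0 E.
have {}g0 k : (k < n)%N -> g k = 0 by move=> kn; apply: (g0 (n - k).-1); lia.
split=> // k kn; apply: faithful => // t u F w tu.
have := coef k t u F w kn tu.
have -> : (if (k < n)%N then ev t * ev u * rho t u (g k) F w else 0) = 0.
  by case: ifP => // kn'; rewrite g0 // (rep0l (rho_rep tu)) mulr0.
rewrite subr0; case: k kn => [|k] kn; first by rewrite addr0.
by rewrite g0 // (rep0l (rho_rep tu)) mulr0 addr0.
Qed.

(** Spanning and independence advance together: an element of K_{n+1} is written in the spanning
    form, and faithfulness on K_n kills its coefficients. The base K_2 is separated by its three
    characters. *)
Lemma gen_subalg_faithful n x : (1 < n <= m)%N -> B n x -> vanishing x -> x = 0.
Proof.
elim: n x => // n IHn x nm Bx x0; have [n1|n1] := ltnP 1 n; last first.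
  have nE : n.+1 = 2 by lia.
  rewrite nE in Bx; apply: gen_subalg2_char0 => //; first by lia.
  by move=> t; have [u tu] : exists u, t <> u by
    [case: t; [exists Green|exists Red|exists Red]]; exists u => //; apply: x0.
have [n0 nm'] : (0 < n)%N /\ (n < m)%N by lia.
have [f [g [Bf Bg xE]]] := gen_subalgS_sum a_neq0 b_neq0 c_neq0 abc_distinct s_system n0 nm' n1 Bx.
have faithful y : B n y -> vanishing y -> y = 0 by apply: IHn; lia.
rewrite xE in x0 *.
have [f0 g0] := vanishing_descs n1 nm' faithful Bf Bg x0.
rewrite !big1 ?addr0 // => k _; first by rewrite g0 ?mul0r.
by rewrite f0 ?mul0r // -ltnS.
Qed.

Lemma descs_independent n (f g : nat -> A) : (1 < n)%N -> (n < m)%N ->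
    (forall k, B n (f k)) -> (forall k, B 2 (g k)) ->
    \sum_(k < n.+1) f k * desc s n k + \sum_(k < n) g k * desc2 s n k = 0 ->
  (forall k, (k <= n)%N -> f k = 0) /\ (forall k, (k < n)%N -> g k = 0).
Proof.
move=> n1 nm Bf Bg x0; apply: vanishing_descs => // [x Bx|t u F w tu].
  by apply: gen_subalg_faithful Bx; lia.
by rewrite x0 (rep0l (rho_rep tu)).
Qed.

Lemma gen_subalg_desc n k : (k <= n)%N -> B n.+1 (desc s n k).
Proof.
elim: k => [|k IHk] kn; first by rewrite desc0; apply: subalg_gen1.
rewrite descS; apply: subalg_genM; first by apply: IHk; apply: ltnW.
by apply: gen_subalg_gen; lia.
Qed.

Let subspan_sum n (I : finType) (e : I -> A) (z : I -> K) :
  (forall i, B n (e i)) -> B n (\sum_i z i *: e i).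
Proof.
move=> Be; elim/big_ind: _ => [|x y Bx By|i _].
- exact: subalg_gen0.
- exact: subalg_genD.
- exact/subalg_genZ/Be.
Qed.

Lemma gen_subalg2_basis : (1 < m)%N ->
  basis_of_sub (B 2) (fun i : 'I_3 => P 1 (nth Red [:: Red; Green; Blue] i)).
Proof.
move=> m1; pose y (z : 'I_3 -> K) t := if t is Red then z ord0
  else if t is Green then z (lift ord0 ord0) else z (lift ord0 (lift ord0 ord0)).
have sum3 z : \sum_(i < 3) z i *: P 1 (nth Red [:: Red; Green; Blue] i)
    = y z Red *: P 1 Red + y z Green *: P 1 Green + y z Blue *: P 1 Blue.
  by rewrite 3!big_ord_recl big_ord0 addr0 addrA.
split.
- by move=> i; apply/subalg_gen_proj/gen_subalg_gen.
- move=> x /(gen_subalg2_proj m1)[z ->].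
  by exists (fun i : 'I_3 => z (nth Red [:: Red; Green; Blue] i)); rewrite sum3.
move=> z; rewrite sum3 => z0.
have {}z0 t := projs_free (z := y z) t m1 z0.
case=> [[|[|[|//]]] i3]; [have := z0 Red|have := z0 Green|have := z0 Blue];
  by move=> /= <-; congr z; apply: val_inj.
Qed.

Lemma gen_subalg_basis n : (1 < n <= m)%N ->
  exists (I : finType) (e : I -> A), basis_of_sub (B n) e /\ #|I| = (3 * (n`! - 1))%N.
Proof.
elim: n => // n IHn nm; have [n1|n1] := ltnP 1 n; last first.
  have -> : n.+1 = 2 by lia.
  exists 'I_3, (fun i : 'I_3 => P 1 (nth Red [:: Red; Green; Blue] i)).
  by split; [apply: gen_subalg2_basis; lia | rewrite card_ord].
have [|I [e [[Be e_span e_free] cardI]]] := IHn; first by lia.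
have m1 : (1 < m)%N by lia.
have nm' : (n < m)%N by lia.
have [Be2 e2_span e2_free] := gen_subalg2_basis m1.
pose e2 (i : 'I_3) := P 1 (nth Red [:: Red; Green; Blue] i).
(* The count is 3(n! - 1)(n + 1) + 3n = 3((n + 1)! - 1). *)
pose e' (x : I * 'I_n.+1 + 'I_3 * 'I_n) : A :=
  match x with inl p => e p.1 * desc s n p.2 | inr p => e2 p.1 * desc2 s n p.2 end.
have sumE (z : I * 'I_n.+1 + 'I_3 * 'I_n -> K) : \sum_x z x *: e' x
    = \sum_(k < n.+1) (\sum_i z (inl (i, k)) *: e i) * desc s n k
      + \sum_(k < n) (\sum_j z (inr (j, k)) *: e2 j) * desc2 s n k.
  rewrite big_sumType /=; congr (_ + _).
    rewrite (eq_bigr (fun p => z (inl (p.1, p.2)) *: (e p.1 * desc s n p.2))); last by case.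
    rewrite -(pair_big xpredT xpredT (fun i k => z (inl (i, k)) *: (e i * desc s n k))) exchange_big /=.
    by apply: eq_bigr => k _; rewrite mulr_suml; apply: eq_bigr => i _; rewrite scalerAl.
  rewrite (eq_bigr (fun p => z (inr (p.1, p.2)) *: (e2 p.1 * desc2 s n p.2))); last by case.
  rewrite -(pair_big xpredT xpredT (fun i k => z (inr (i, k)) *: (e2 i * desc2 s n k))) exchange_big /=.
  by apply: eq_bigr => k _; rewrite mulr_suml; apply: eq_bigr => i _; rewrite scalerAl.
exists (I * 'I_n.+1 + 'I_3 * 'I_n)%type, e'; split; last first.
  rewrite card_sum !card_prod !card_ord cardI factS.
  by have := fact_gt0 n; nia.
split.
- case=> [[i k]|[i k]] /=; apply: subalg_genM.
  + by apply: gen_subalg_le (Be i).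
  + by apply: gen_subalg_desc; rewrite -ltnS.
  + by apply: gen_subalg_le (Be2 i); lia.
  + apply: subalg_genM; first by apply: gen_subalg_desc; apply: ltnW.
    by apply/subalg_genX2/gen_subalg_gen; have := ltn_ord k; lia.
- move=> x Bx; have [f [g [Bf Bg ->]]] := gen_subalgS_sum a_neq0 b_neq0 c_neq0 abc_distinct
    s_system (ltnW n1) nm' n1 Bx.
  have [zf zfE] := boolp.choice (fun k => e_span _ (Bf k)).
  have [zg zgE] := boolp.choice (fun k => e2_span _ (Bg k)).
  exists (fun x : I * 'I_n.+1 + 'I_3 * 'I_n =>
    match x with inl p => zf p.2 p.1 | inr p => zg p.2 p.1 end).
  by rewrite sumE; congr (_ + _); apply: eq_bigr => k _; rewrite -?zfE -?zgE.
- move=> z; rewrite sumE => z0.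
  pose f k := oapp (fun k => \sum_i z (inl (i, k)) *: e i) 0 (insub k).
  pose g k := oapp (fun k => \sum_i z (inr (i, k)) *: e2 i) 0 (insub k).
  have fE (k : 'I_n.+1) : f k = \sum_i z (inl (i, k)) *: e i by rewrite /f valK.
  have gE (k : 'I_n) : g k = \sum_i z (inr (i, k)) *: e2 i by rewrite /g valK.
  have [|||f0 g0] := @descs_independent n f g n1 nm'.
  + move=> k; rewrite /f; case: insubP => [k' _ _|_] /=; last exact: subalg_gen0.
    by apply: subspan_sum => i; apply: Be.
  + move=> k; rewrite /g; case: insubP => [k' _ _|_] /=; last exact: subalg_gen0.
    by apply: subspan_sum => i; apply: Be2.
  + by rewrite -[RHS]z0; congr (_ + _); apply: eq_bigr => k _; rewrite ?fE ?gE.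
  case=> [[i k]|[i k]].
    by apply: (e_free (fun i => z (inl (i, k)))); rewrite -fE f0 // -ltnS.
  by apply: (e2_free (fun i => z (inr (i, k)))); rewrite -gE g0.
Qed.

Lemma descs_direct_sum n : (1 < n)%N -> (n < m)%N -> (forall x, B n.+1 x) ->
  is_direct_sum (B n :: [seq rtranslate (B n) (desc s n k) | k <- iota 1 n]
    ++ [seq rtranslate (B 2) (desc s n k.-1 * s (n - k).+1 ^+ 2) | k <- iota 1 n]).
Proof.
move=> n1 nm full; set W := _ :: _; pose N := size W.
have NE : N = (n.+1 + n)%N by rewrite /N /= size_cat !size_map !size_iota.
(* Entry 0 of the list is [B n] itself, covered by [desc s n 0 = 1]. *)
have W1 k y : (k <= n)%N ->
    nth (fun=> False) W k y <-> exists2 w, B n w & y = w * desc s n k.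
  case: k => [_|k kn] /=; first by rewrite desc0; split=> [By|[w Bw ->]]; [exists y|];
    rewrite ?mulr1.
  by rewrite nth_cat size_map size_iota kn (nth_map 0%N) ?size_iota // nth_iota.
(* The second family is listed from 1, so its member at [k.+1] is the one built on [desc2 s n k]. *)
have W2 k y : (k < n)%N ->
    nth (fun=> False) W (n.+1 + k) y <-> exists2 w, B 2 w & y = w * desc2 s n k.
  move=> kn; rewrite /= nth_cat size_map size_iota ifN ?addKn; last by lia.
  rewrite (nth_map 0%N) ?size_iota // nth_iota // add1n /=.
  by rewrite (_ : (n - k.+1).+1 = n - k)%N //; lia.
have sumE (U : nat -> A) :
    \sum_(i < N) U i = \sum_(k < n.+1) U k + \sum_(k < n) U (n.+1 + k)%N.
  by rewrite NE big_split_ord.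
have coefs (U : nat -> A) : (forall i, (i < N)%N -> nth (fun=> False) W i (U i)) ->
  exists f g : nat -> A, [/\ forall k, B n (f k), forall k, B 2 (g k),
    forall k, (k <= n)%N -> U k = f k * desc s n k
    & forall k, (k < n)%N -> U (n.+1 + k)%N = g k * desc2 s n k].
  move=> UW.
  have exf k : exists w, B n w /\ ((k <= n)%N -> U k = w * desc s n k).
    case: (leqP k n) => kn; last by exists 0; split=> //; apply: subalg_gen0.
    by have [|w Bw ->] := (W1 k (U k) kn).1; [apply: UW; lia | exists w].
  have exg k : exists w, B 2 w /\ ((k < n)%N -> U (n.+1 + k)%N = w * desc2 s n k).
    case: (ltnP k n) => kn; last by exists 0; split=> //; apply: subalg_gen0.
    by have [|w Bw ->] := (W2 k (U (n.+1 + k)%N) kn).1; [apply: UW; lia | exists w].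
  have [f fE] := boolp.choice exf; have [g gE] := boolp.choice exg.
  by exists f, g; split=> k; [case: (fE k) | case: (gE k) | case: (fE k) | case: (gE k)].
apply: is_direct_sumP => [v|U U' /coefs[f [g [Bf Bg fE gE]]] /coefs[f' [g' [Bf' Bg' fE' gE']]]].
  have [f [g [Bf Bg ->]]] := gen_subalgS_sum a_neq0 b_neq0 c_neq0 abc_distinct
    s_system (ltnW n1) nm n1 (full v).
  pose U i := if (i <= n)%N then f i * desc s n i else g (i - n.+1)%N * desc2 s n (i - n.+1).
  exists U => [i|]; rewrite -[size _]/N.
    move=> iN; rewrite /U; case: leqP => ni; first by apply/W1 => //; exists (f i).
    have {1}-> : i = (n.+1 + (i - n.+1))%N by lia.
    by apply/W2; [lia | exists (g (i - n.+1)%N)].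
  rewrite sumE /U; congr (_ + _); apply: eq_bigr => k _; first by rewrite -ltnS ltn_ord.
  by rewrite ifN ?addKn //; lia.
rewrite -[size _]/N !sumE => UU'.
have [|||f0 g0] := @descs_independent n (fun k => f k - f' k) (fun k => g k - g' k) n1 nm.
- by move=> k; apply: subalg_genB; [apply: Bf | apply: Bf'].
- by move=> k; apply: subalg_genB; [apply: Bg | apply: Bg'].
- move/eqP: UU'; rewrite -subr_eq0 opprD addrACA -!sumrB => /eqP UU'.
  rewrite -[RHS]UU'; congr (_ + _); apply: eq_bigr => k _.
    by rewrite mulrBl fE ?fE' // -ltnS.
  by rewrite mulrBl gE ?gE'.
move=> i iN; have [ni|ni] := leqP i n.
  by rewrite fE // fE' //; have /eqP := f0 i ni; rewrite subr_eq0 => /eqP->.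
have -> : i = (n.+1 + (i - n.+1))%N by lia.
have kn : (i - n.+1 < n)%N by lia.
by rewrite gE // gE' //; have /eqP := g0 _ kn; rewrite subr_eq0 => /eqP->.
Qed.

End Independence.

Lemma jimbo_calK_reps (K : fieldType) (a b c : K) (n : nat) :
    a != 0 -> b != 0 -> c != 0 ->
  exists rho : color -> color -> calK a b c n -> ((nat -> nat) -> K^o) -> (nat -> nat) -> K^o,
    (forall t u, t <> u -> is_rep (rho t u)) /\
    (forall t u i F, t <> u -> (0 < i < n)%N ->
      rho t u (calK_gen a b c n i) F = jimbo (ev a b c t) (ev a b c u) i F).
Proof.
move=> a0 b0 c0.
have [tu|rho rhoE] := boolp.choice (P := fun (tu : color * color) rho =>
    tu.1 <> tu.2 -> is_rep rho /\ forall i F, (0 < i < n)%N ->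
      rho (calK_gen a b c n i) F = jimbo (ev a b c tu.1) (ev a b c tu.2) i F).
  (* Equal colors receive a dummy value. *)
  case: tu => t u /=; have [<-|tu] := color_eq_dec t u; first by exists (fun _ F => F).
  by have [rho] := jimbo_calK_rep n a0 b0 c0 tu; exists rho.
exists (fun t u => rho (t, u)); split=> [t u tu|t u i F tu im].
  by case: (rhoE (t, u) tu).
by case: (rhoE (t, u) tu) => _; apply.
Qed.

Theorem proposition2p13 (K : fieldType) (a b c : K) (n : nat)
    (char0 : [pchar K] =i pred0)
    (a_neq0 : a != 0) (b_neq0 : b != 0) (c_neq0 : c != 0)
    (abc_distinct : (a - b) * (a - c) * (b - c) != 0)
    (H3_split : split_semisimple (cubicH a b c 3))
    (H4_split : split_semisimple (cubicH a b c 4))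
    (n_ge2 : (2 <= n)%N) :
  has_dim (calK a b c n) (3 * (n`! - 1)) /\
  is_direct_sum
    (calK_sub n
     :: [seq rtranslate (calK_sub n) (s_desc a b c n k) | k <- iota 1 n]
     ++ [seq rtranslate (calK_sub 2) (x_desc a b c n k) | k <- iota 1 n]).
Proof.
split.
  have [rho [rho_rep rho_gen]] := jimbo_calK_reps n a_neq0 b_neq0 c_neq0.
  have n1n : (1 < n <= n)%N by rewrite n_ge2 leqnn.
  have [I [e [[_ e_span e_free] cardI]]] := @gen_subalg_basis K (calK a b c n) a b c
    a_neq0 b_neq0 c_neq0 abc_distinct (calK_gen a b c n) n
    (calK_system n a_neq0 b_neq0 c_neq0) rho rho_rep rho_gen n n1n.
  rewrite -cardI; apply: (has_dim_basis (e := e)); split=> // x _; apply: e_span.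
  exact: gen_subalg_full.
(* The dimension was computed in K_n; the decomposition takes place in K_{n+1}, whose generators
   define [calK_sub], [s_desc] and [x_desc]. *)
have [rho [rho_rep rho_gen]] := jimbo_calK_reps n.+1 a_neq0 b_neq0 c_neq0.
exact: (@descs_direct_sum K (calK a b c n.+1) a b c
  a_neq0 b_neq0 c_neq0 abc_distinct (calK_gen a b c n.+1) n.+1
  (calK_system n.+1 a_neq0 b_neq0 c_neq0) rho rho_rep rho_gen n n_ge2 (leqnn _)
  (gen_subalg_full a_neq0 b_neq0 c_neq0)).
Qed.
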